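(* Let $\mathcal{C}$ be a fixed (finite) collection of configurations, each of which can be generated by a set of $m$ of its points, where $m$ is a fixed positive integer. Then all configurations in a given Steiner triple system of order $v$ that are isomorphic to a configuration in $\mathcal{C}$ can be listed (each exactly once) in time $O(v^m)$.
   Context: A Steiner triple system of order $v$, STS$(v)$, is a pair $(V,\mathcal{B})$ with $|V|=v$ and $\mathcal{B}$ a set of 3-subsets (blocks/lines) of $V$ such that every 2-subset of $V$ lies in exactly one block. A configuration in $(V,\mathcal{B})$ is a set system $(V',\mathcal{B}')$ with $\mathcal{B}'\subseteq\mathcal{B}$ and $V'=\bigcup_{B\in\mathcal{B}'}B$; two configurations are isomorphic if there is a bijection of their point sets mapping lines onto lines. For a configuration with point set $V$ and line set $\mathcal{B}$ and a subset $V_0\subseteq V$, define $V_{i+1}=V_i\cup\{z:\{x,y,z\}\in\mathcal{B},\ x,y\in V_i\}$; the sequence stabilizes at some $V_j$, the closure of $V_0$. The configuration is generated by $V_0$ if the closure of $V_0$ is its whole point set $V$. The STS is given as input (e.g. as its list of blocks); the configurations in $\mathcal{C}$ are fixed, not part of the input. *)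

(* Defs.v *)
From HB Require Import structures.
From mathcomp Require Import all_boot.

Set Implicit Arguments.
Unset Strict Implicit.
Unset Printing Implicit Defensive.

Definition is_sts (V : finType) (B : {set {set V}}) : Prop :=
  (forall b, b \in B -> #|b| = 3) /\
  (forall e : {set V}, #|e| = 2 -> #|[set b in B | e \subset b]| = 1).

(* A configuration in (V, B) is determined by its set of lines L \subset B;
   its point set is cover L. *)
Record configuration := Configuration {
  ambient_points : finType;
  ambient_blocks : {set {set ambient_points}};
  ambient_sts : is_sts ambient_blocks;
  lines : {set {set ambient_points}};
  lines_sub : lines \subset ambient_blocks
}.

Section Generation.
Variables (V : finType) (L : {set {set V}}).

Definition gen_step (A : {set V}) : {set V} :=
  A :|: [set z | [exists x in A, exists y in A, [set x; y; z] \in L]].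

(* The sequence V_0, V_1, ... is nondecreasing, hence stationary from index
   #|V| on: see gen_closure_stable. *)
Definition gen_closure (V0 : {set V}) : {set V} := iter #|V| gen_step V0.

Definition generated_by (V0 : {set V}) : Prop := gen_closure V0 = cover L.

Lemma gen_step_sub (A : {set V}) : A \subset gen_step A.
Proof. exact: subsetUl. Qed.

Lemma gen_closure_stable (V0 : {set V}) : gen_step (gen_closure V0) = gen_closure V0.
Proof.
have [j le_j fix_j] : exists2 j, j <= #|V| &
    gen_step (iter j gen_step V0) = iter j gen_step V0.
  case: (pickP (fun j : 'I_#|V|.+1 =>
    gen_step (iter j gen_step V0) == iter j gen_step V0)) => [j /eqP fj | nofix].
    by exists j => //; rewrite -ltnS ltn_ord.
  have grow j : j <= #|V|.+1 -> j <= #|iter j gen_step V0|.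
    elim: j => // j IHj lt_j; apply: leq_ltn_trans (IHj (ltnW lt_j)) _.
    apply: proper_card; rewrite properEneq gen_step_sub andbT eq_sym.
    by rewrite (nofix (Ordinal lt_j)).
  by have := leq_trans (grow _ (leqnn _)) (max_card _); rewrite ltnn.
have stat i : iter (i + j) gen_step V0 = iter j gen_step V0.
  by elim: i => // i IHi; rewrite addSn iterS IHi fix_j.
by rewrite /gen_closure -(subnK le_j) stat fix_j.
Qed.

End Generation.

Definition generated_by_card (m : nat) (K : configuration) : Prop :=
  exists V0 : {set ambient_points K},
    [/\ V0 \subset cover (lines K), #|V0| = m & generated_by (lines K) V0].

(* Every line of L1 is the image under val of a set of points of L1, and the
   bijection f is required to match such sets with those of L2. *)
Definition isomorphic (V1 V2 : finType)
    (L1 : {set {set V1}}) (L2 : {set {set V2}}) : Prop :=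
  exists f : {x | x \in cover L1} -> {x | x \in cover L2},
    bijective f /\
    forall b : {set {x | x \in cover L1}},
      (val @: b \in L1) = (val @: (f @: b) \in L2).

(* The model of computation is the word RAM: finitely many registers, a
   word-addressable memory, a write-only output stream, and unit-cost
   instructions.  Control flow is structured (if / while) instead of being given
   by jumps; each test costs one unit, so that programs translate to jump code
   with constant overhead per unit of cost. *)
Definition reg := nat.

Inductive binop := Add | Sub | Mul.
Inductive cmp := CmpEq | CmpLt.

Inductive prog :=
| Skip
| Const of reg & nat            (* r := n *)
| Op of binop & reg & reg & reg (* r := r1 op r2 *)
| Fetch of reg & reg             (* r := mem[a] *)
| Store of reg & reg            (* mem[a] := r *)
| Output of reg
| Seq of prog & prog
| If of cmp & reg & reg & prog & prog
| While of cmp & reg & reg & prog.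

Definition eval_binop (o : binop) : nat -> nat -> nat :=
  match o with Add => addn | Sub => subn | Mul => muln end.

Definition eval_cmp (c : cmp) (x y : nat) : bool :=
  match c with CmpEq => x == y | CmpLt => x < y end.

Record state := State {
  regs : reg -> nat;
  mem : nat -> nat;
  outp : seq nat
}.

Definition upd (f : nat -> nat) (i x : nat) : nat -> nat :=
  fun j => if j == i then x else f j.

Definition set_reg (s : state) (r : reg) (x : nat) : state :=
  State (upd (regs s) r x) (mem s) (outp s).

(* exec W p s t s': on a machine whose words hold the numbers below W, p leads
   from s to s' in exactly t units of time.  An instruction whose result does
   not fit in a word has no transition; addresses are register contents, so
   they are words too. *)
Inductive exec (W : nat) : prog -> state -> nat -> state -> Prop :=
| ExecSkip s : exec W Skip s 1 s
| ExecConst s r n : n < W -> exec W (Const r n) s 1 (set_reg s r n)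
| ExecOp s o r r1 r2 :
    eval_binop o (regs s r1) (regs s r2) < W ->
    exec W (Op o r r1 r2) s 1
      (set_reg s r (eval_binop o (regs s r1) (regs s r2)))
| ExecFetch s r a : exec W (Fetch r a) s 1 (set_reg s r (mem s (regs s a)))
| ExecStore s a r :
    exec W (Store a r) s 1
      (State (regs s) (upd (mem s) (regs s a) (regs s r)) (outp s))
| ExecOutput s r :
    exec W (Output r) s 1 (State (regs s) (mem s) (rcons (outp s) (regs s r)))
| ExecSeq p1 p2 s s1 s2 t1 t2 :
    exec W p1 s t1 s1 -> exec W p2 s1 t2 s2 ->
    exec W (Seq p1 p2) s (t1 + t2) s2
| ExecIfTrue c r1 r2 p1 p2 s s' t :
    eval_cmp c (regs s r1) (regs s r2) -> exec W p1 s t s' ->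
    exec W (If c r1 r2 p1 p2) s t.+1 s'
| ExecIfFalse c r1 r2 p1 p2 s s' t :
    ~~ eval_cmp c (regs s r1) (regs s r2) -> exec W p2 s t s' ->
    exec W (If c r1 r2 p1 p2) s t.+1 s'
| ExecWhileTrue c r1 r2 p s s1 s2 t1 t2 :
    eval_cmp c (regs s r1) (regs s r2) -> exec W p s t1 s1 ->
    exec W (While c r1 r2 p) s1 t2 s2 ->
    exec W (While c r1 r2 p) s (t1 + t2).+1 s2
| ExecWhileFalse c r1 r2 p s :
    ~~ eval_cmp c (regs s r1) (regs s r2) ->
    exec W (While c r1 r2 p) s 1 s.

(* The input occupies memory cells 0, 1, ...; all other cells and all registers
   are initially 0. *)
Definition init_state (input : seq nat) : state :=
  State (fun=> 0) (nth 0 input) [::].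

Definition runs (p : prog) (W : nat) (input : seq nat) (t : nat)
    (output : seq nat) : Prop :=
  all (fun x => x < W) input /\
  exists2 s, exec W p (init_state input) t s & outp s = output.

Definition triple (v : nat) : Type := 'I_v * 'I_v * 'I_v.

Definition block_of (v : nat) (a : triple v) : {set 'I_v} :=
  [set a.1.1; a.1.2; a.2].

Definition triple_code (v : nat) (a : triple v) : seq nat :=
  [:: val a.1.1; val a.1.2; val a.2].

Definition blocks_code (v : nat) (s : seq (triple v)) : seq nat :=
  size s :: flatten (map (@triple_code v) s).

(* s lists the blocks in B, each once, in any order, and the points of each
   block in any order. *)
Definition block_list (v : nat) (s : seq (triple v)) (B : {set {set 'I_v}}) :
    Prop :=
  uniq (map (@block_of v) s) /\ map (@block_of v) s =i B.

Definition sts_input (v : nat) (s : seq (triple v)) : seq nat :=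
  v :: blocks_code s.

(* output is the concatenation of the codes of configurations (line sets) D in
   the sequence Ds, which contains precisely the D satisfying P, without
   repetition. *)
Definition lists_exactly_once (v : nat) (P : {set {set 'I_v}} -> Prop)
    (output : seq nat) : Prop :=
  exists (Ds : seq {set {set 'I_v}}) (ss : seq (seq (triple v))),
    [/\ uniq Ds,
        forall D, D \in Ds <-> P D,
        size ss = size Ds,
        forall i, i < size Ds -> block_list (nth [::] ss i) (nth set0 Ds i)
      & output = flatten (map (@blocks_code v) ss)].

(* Main.v *)
(* A configuration with no more than one generator would be a single point, so
   m >= 2 and there is time to read all blocks into a v x v table giving the
   third point of the block through two points.  Run through all assignments of
   points of the system to the m generators; each one extends by table lookups,
   in constant time, to at most one embedding of the configuration.  An image D
   arises from several embeddings, but any two of them differ by an automorphism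
   of the (fixed) configuration.  Hence D is output exactly once if it is output
   only for the embedding f whose values, read as base-v digits, form a number
   not exceeding the one of f o a for any automorphism a.  Isomorphic members of
   the collection are discarded when the program is written. *)
From HB Require Import structures.
From mathcomp Require Import all_boot zify.
(* Imported last: [mem] and [Sub] below are those of the machine. *)
Require Import Defs.

Set Implicit Arguments.
Unset Strict Implicit.
Unset Printing Implicit Defensive.

(** * Running programs within a time bound *)

(** The table is total. Its diagonal cells are never written and keep the value 0, which is a point,
    so every assignment of the generators extends to some map on all points. No lookup can fail:
    whether the map is an embedding is decided afterwards, by tests that clear a flag.

    The closure of the generators is compiled into a repetition-free list of points, each the third
    point of a line through two earlier ones. Freedom from repetition matters twice: an embedding is
    recovered from its values on the generators, and no step overwrites a generator, whose register
    is also a loop counter.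

    Combinatorics and machine are kept apart: one argument shows that the accepted extensions list
    each copy once, another that the program prints exactly these in the order of its nested loops.

    Words hold the numbers below a power of [v + 2], which is at least 2 even for [v = 0]. The
    exponent depends on the collection only; it must cover table addresses and the code of an
    embedding, whose number of digits is the number of all points and not just [m]. Loop overhead
    yields the bound [v.+1 ^ m], which costs a factor [2 ^ m] in the end. *)

Definition runs_in (W : nat) (p : prog) (s : state) (T : nat)
    (Q : state -> Prop) : Prop :=
  exists t s', [/\ exec W p s t s', t <= T & Q s'].

Lemma runs_in_weaken W p s T T' (Q Q' : state -> Prop) :
  runs_in W p s T Q -> T <= T' -> (forall s', Q s' -> Q' s') ->
  runs_in W p s T' Q'.
Proof.
move=> [t [s' [ex le_t Qs']]] leT QQ'; exists t, s'.
by split=> //; [apply: leq_trans leT | apply: QQ'].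
Qed.

Lemma runs_in_seq W p1 p2 s T1 T2 Q :
  runs_in W p1 s T1 (fun s1 => runs_in W p2 s1 T2 Q) ->
  runs_in W (Seq p1 p2) s (T1 + T2) Q.
Proof.
move=> [t1 [s1 [ex1 le1 [t2 [s2 [ex2 le2 Qs2]]]]]]; exists (t1 + t2), s2.
by split=> //; [apply: ExecSeq ex1 ex2 | apply: leq_add].
Qed.

Lemma runs_in_if W c r1 r2 p1 p2 s T Q :
  (eval_cmp c (regs s r1) (regs s r2) -> runs_in W p1 s T Q) ->
  (~~ eval_cmp c (regs s r1) (regs s r2) -> runs_in W p2 s T Q) ->
  runs_in W (If c r1 r2 p1 p2) s T.+1 Q.
Proof.
case: (boolP (eval_cmp _ _ _)) => test.
  move=> /(_ isT) [t [s' [ex le_t Qs']]] _; exists t.+1, s'.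
  by split=> //; apply: ExecIfTrue.
move=> _ /(_ isT) [t [s' [ex le_t Qs']]]; exists t.+1, s'.
by split=> //; apply: ExecIfFalse.
Qed.

(** Each of the [n] rounds pays for its test, and the failing test on exit costs one unit more. The
    induction is on the number [k] of rounds still to come. *)
Lemma runs_in_while W c r1 r2 p T n (Inv : nat -> state -> Prop) s :
  (forall i s1, Inv i s1 -> eval_cmp c (regs s1 r1) (regs s1 r2) = (i < n)) ->
  (forall i s1, i < n -> Inv i s1 -> runs_in W p s1 T (Inv i.+1)) ->
  Inv 0 s -> runs_in W (While c r1 r2 p) s (n * T.+1).+1 (Inv n).
Proof.
move=> test step inv0.
have loop k i s1 : i + k = n -> Inv i s1 ->
    runs_in W (While c r1 r2 p) s1 (k * T.+1).+1 (Inv n).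
  elim: k i s1 => [|k IHk] i s1 def_n inv_i.
    exists 1, s1; rewrite -def_n addn0; split=> //.
    by apply: ExecWhileFalse; rewrite (test _ _ inv_i) -def_n addn0 ltnn.
  have lt_in : i < n by rewrite -def_n addnS ltnS leq_addr.
  have [t1 [s2 [ex1 le1 inv_i1]]] := step _ _ lt_in inv_i.
  have [|t2 [s3 [ex2 le2 inv_n]]] := IHk i.+1 s2 _ inv_i1.
    by rewrite addSnnS.
  exists (t1 + t2).+1, s3; split=> //; last by rewrite mulSn; lia.
  by apply: ExecWhileTrue ex1 ex2; rewrite (test _ _ inv_i).
exact: loop inv0.
Qed.

(* Worst-case time of a loop-free program; the value for [While] is junk. *)
Fixpoint cost (p : prog) : nat :=
  match p with
  | Seq p1 p2 => cost p1 + cost p2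
  | If _ _ _ p1 p2 => (maxn (cost p1) (cost p2)).+1
  | _ => 1
  end.

(** The time bound is the syntactic [cost], so statements about loop-free code need not mention time
    at all. *)
Definition ok (W : nat) (p : prog) (s : state) (Q : state -> Prop) : Prop :=
  runs_in W p s (cost p) Q.

Lemma ok_weaken W p s (Q Q' : state -> Prop) :
  ok W p s Q -> (forall s', Q s' -> Q' s') -> ok W p s Q'.
Proof. by move=> okp; apply: runs_in_weaken okp _. Qed.

Lemma ok_skip W s (Q : state -> Prop) : Q s -> ok W Skip s Q.
Proof. by move=> Qs; exists 1, s; split=> //; constructor. Qed.

Lemma ok_const W r n s (Q : state -> Prop) :
  n < W -> Q (set_reg s r n) -> ok W (Const r n) s Q.
Proof. by move=> ltW Qs; eexists _, _; split; first by constructor. Qed.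

Lemma ok_op W o r r1 r2 s (Q : state -> Prop) :
  eval_binop o (regs s r1) (regs s r2) < W ->
  Q (set_reg s r (eval_binop o (regs s r1) (regs s r2))) ->
  ok W (Op o r r1 r2) s Q.
Proof. by move=> ltW Qs; eexists _, _; split; first by constructor. Qed.

Lemma ok_fetch W r a s (Q : state -> Prop) :
  Q (set_reg s r (mem s (regs s a))) -> ok W (Fetch r a) s Q.
Proof. by move=> Qs; eexists _, _; split; first by constructor. Qed.

Lemma ok_store W a r s (Q : state -> Prop) :
  Q (State (regs s) (upd (mem s) (regs s a) (regs s r)) (outp s)) ->
  ok W (Store a r) s Q.
Proof. by move=> Qs; eexists _, _; split; first by constructor. Qed.

Lemma ok_output W r s (Q : state -> Prop) :
  Q (State (regs s) (mem s) (rcons (outp s) (regs s r))) -> ok W (Output r) s Q.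
Proof. by move=> Qs; eexists _, _; split; first by constructor. Qed.

Lemma ok_seq W p1 p2 s Q :
  ok W p1 s (fun s1 => ok W p2 s1 Q) -> ok W (Seq p1 p2) s Q.
Proof. exact: runs_in_seq. Qed.

Lemma ok_if W c r1 r2 p1 p2 s Q :
  (eval_cmp c (regs s r1) (regs s r2) -> ok W p1 s Q) ->
  (~~ eval_cmp c (regs s r1) (regs s r2) -> ok W p2 s Q) ->
  ok W (If c r1 r2 p1 p2) s Q.
Proof.
move=> ok1 ok2; apply: runs_in_if => test.
  by apply: runs_in_weaken (ok1 test) _ _; rewrite ?leq_maxl.
by apply: runs_in_weaken (ok2 test) _ _; rewrite ?leq_maxr.
Qed.

Definition seqs (A : Type) (p : A -> prog) (xs : seq A) : prog :=
  foldr (fun x q => Seq (p x) q) Skip xs.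

(** [e] is a ghost value, absent from the machine: it records what has been done so far and is
    folded along [xs] in step with the program. *)
Lemma ok_seqs W (A : eqType) (E : Type) (p : A -> prog) (xs : seq A)
    (upd1 : E -> A -> E) (Inv : E -> state -> Prop) (e : E) (s : state) :
  {in xs, forall x e1 s1, Inv e1 s1 -> ok W (p x) s1 (Inv (upd1 e1 x))} ->
  Inv e s -> ok W (seqs p xs) s (Inv (foldl upd1 e xs)).
Proof.
elim: xs e s => [|x xs IHxs] e s step inv_e /=; first exact: ok_skip.
apply: ok_seq; apply: ok_weaken (step x (mem_head _ _) _ _ inv_e) _ => s1.
by apply: IHxs => y ys; apply: step; rewrite inE ys orbT.
Qed.

(** * Registers and the table of third points *)

Notation r_zero := 0 (only parsing).
Notation r_one := 1 (only parsing).
Notation r_v := 2 (only parsing).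
Notation r_base := 3 (only parsing).
Notation r_flag := 4 (only parsing).
Notation r_addr := 5 (only parsing).
Notation r_code := 6 (only parsing).
Notation r_code' := 7 (only parsing).
Notation r_x := 8 (only parsing).
Notation r_y := 9 (only parsing).
Notation r_z := 10 (only parsing).
Notation r_ptr := 11 (only parsing).

(** Registers below 12 have the fixed purposes above; the points of a configuration use those from
    12 on, so the two kinds never clash. *)
Definition point_reg (i : nat) : reg := 12 + i.

Definition cell (v base x y : nat) : nat := x * v + y + base.

Definition address (x y : reg) : prog :=
  Seq (Op Mul r_addr x r_v) (Seq (Op Add r_addr r_addr y)
    (Op Add r_addr r_addr r_base)).

Lemma cell_lt v base (x y : 'I_v) : cell v base x y < v * v + base.
Proof. by rewrite /cell ltn_add2r; have := ltn_ord x; have := ltn_ord y; nia. Qed.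

Lemma cell_inj v base (x y x' y' : 'I_v) :
  cell v base x y = cell v base x' y' -> x = x' /\ y = y'.
Proof.
move/addIn => eq_xy.
have eq_y : y = y'.
  by apply: val_inj; have := congr1 (modn^~ v) eq_xy; rewrite !modnMDl !modn_small.
split=> //; apply: val_inj => /=; move: eq_xy; rewrite eq_y => /addIn /eqP.
by rewrite eqn_pmul2r ?(leq_ltn_trans _ (ltn_ord y)) // => /eqP.
Qed.

Definition same_except (r : reg) (s s' : state) : Prop :=
  [/\ mem s' = mem s, outp s' = outp s
    & forall r', r' != r -> regs s' r' = regs s r'].

Lemma ok_address W v base (i j : 'I_v) (x y : reg) s :
  v * v + base <= W -> regs s r_v = v -> regs s r_base = base ->
  y != r_addr -> regs s x = i -> regs s y = j ->
  ok W (address x y) s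
    (fun s' => same_except r_addr s s' /\ regs s' r_addr = cell v base i j).
Proof.
move=> leW s_v s_base neq_y s_x s_y; have := cell_lt base i j; rewrite /cell => ltW.
apply: ok_seq; apply: ok_op => /=; first by rewrite s_x s_v; lia.
apply: ok_seq; apply: ok_op => /=.
  by rewrite /upd /= (negPf neq_y) s_x s_y s_v; lia.
apply: ok_op => [|/=].
  by rewrite /= /upd /= (negPf neq_y) s_x s_y s_v s_base (leq_trans ltW).
split; last by rewrite /= /upd /= (negPf neq_y) s_x s_y s_v s_base.
by split=> // r' /negPf neq_r; rewrite /= /upd neq_r.
Qed.

Definition put (x y z : reg) : prog := Seq (address x y) (Store r_addr z).

Lemma ok_put W v base (i j k : 'I_v) (x y z : reg) s :
  v * v + base <= W -> regs s r_v = v -> regs s r_base = base ->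
  y != r_addr -> z != r_addr ->
  regs s x = i -> regs s y = j -> regs s z = k ->
  ok W (put x y z) s (fun s' =>
    [/\ mem s' = upd (mem s) (cell v base i j) k, outp s' = outp s
      & forall r', r' != r_addr -> regs s' r' = regs s r']).
Proof.
move=> leW s_v s_base neq_y neq_z s_x s_y s_z; apply: ok_seq.
apply: ok_weaken (ok_address leW s_v s_base neq_y s_x s_y) _ => s1.
by case=> -[mem1 out1 reg1] addr1; apply: ok_store => /=; rewrite addr1 mem1 reg1 ?s_z.
Qed.

Definition lookup (r x y : reg) : prog := Seq (address x y) (Fetch r r_addr).

Lemma ok_lookup W v base (i j : 'I_v) (r x y : reg) s :
  v * v + base <= W -> regs s r_v = v -> regs s r_base = base ->
  y != r_addr -> regs s x = i -> regs s y = j ->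
  ok W (lookup r x y) s (fun s' =>
    [/\ mem s' = mem s, outp s' = outp s,
        regs s' r = mem s (cell v base i j)
      & forall r', r' != r_addr -> r' != r -> regs s' r' = regs s r']).
Proof.
move=> leW s_v s_base neq_y s_x s_y; apply: ok_seq.
apply: ok_weaken (ok_address leW s_v s_base neq_y s_x s_y) _ => s1.
case=> -[mem1 out1 reg1] addr1; apply: ok_fetch; split=> //=.
  by rewrite /upd eqxx addr1 mem1.
by move=> r' neq_addr /negPf neq_r; rewrite /upd neq_r reg1.
Qed.

(** A block has three points, so [x] and [y] are distinct and only one block contains both; [z] is
    its point outside the pair. *)
Lemma sts_third (V : finType) (B : {set {set V}}) (x y z z' : V) :
  is_sts B -> [set x; y; z] \in B -> [set x; y; z'] \in B -> z = z'.
Proof.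
move=> [card3 pairs] Bz Bz'; have := card3 _ Bz; rewrite setUC cardsU1 cards2 !inE.
case: eqVneq => // neq_zx; case: eqVneq => // neq_zy; case: eqVneq => // neq_xy _.
have /eqP/cards1P[b0 def_b0] : #|[set b in B | [set x; y] \subset b]| = 1.
  by apply: pairs; rewrite cards2 neq_xy.
have inb z1 : [set x; y; z1] \in B -> [set x; y; z1] = b0.
  by move=> Bz1; apply/set1P; rewrite -def_b0 inE Bz1 subsetUl.
have : z \in [set x; y; z'] by rewrite (inb _ Bz') -(inb _ Bz) !inE eqxx orbT.
by rewrite !inE (negPf neq_zx) (negPf neq_zy) => /eqP.
Qed.

(** The whole memory is fixed, since nothing is stored once the table is built. *)
Definition ready (v base : nat) (M : nat -> nat) (s : state) : Prop :=
  [/\ regs s r_zero = 0, regs s r_one = 1, regs s r_v = v, regs s r_base = base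
    & mem s = M].

Lemma nth_triple_codes v (a0 : triple v) (s : seq (triple v)) i j :
  i < size s -> j < 3 ->
  nth 0 (flatten (map (@triple_code v) s)) (3 * i + j)
  = nth 0 (triple_code (nth a0 s i)) j.
Proof.
elim: s i => // a s IHs [|i] lt_i lt_j; rewrite (nth_cat 0 (triple_code a)) /=.
  by rewrite muln0 add0n lt_j.
by rewrite mulnS -addnA ltnNge leq_addr addKn IHs.
Qed.

Lemma size_triple_codes v (s : seq (triple v)) :
  size (flatten (map (@triple_code v) s)) = 3 * size s.
Proof. by elim: s => //= a s ->; rewrite mulnS. Qed.

Lemma perms_block (V : finType) (x y z : V) :
  [/\ [set x; z; y] = [set x; y; z], [set y; x; z] = [set x; y; z],
      [set y; z; x] = [set x; y; z], [set z; x; y] = [set x; y; z]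
    & [set z; y; x] = [set x; y; z]].
Proof.
by split; apply/setP=> u; rewrite !inE;
  case: (u == x); case: (u == y); case: (u == z).
Qed.

Section Table.

Variables (v : nat) (B : {set {set 'I_v}}) (s : seq (triple v)).
Hypotheses (stsB : is_sts B) (listB : block_list s B).

Lemma block_listP a : a \in s -> block_of a \in B.
Proof. by case: listB => _ <- a_s; apply: map_f. Qed.

(** The first two listed points determine the block, so the list injects into the pairs of points.
    This bounds the time for filling the table as well as its address. *)
Lemma size_block_list : size s <= v * v.
Proof.
case: listB => uniq_s _.
rewrite -(size_map (fun a : triple v => (a.1.1, a.1.2))) -[v in v * _]card_ord.
rewrite -[v in _ * v]card_ord -card_prod.
suff /card_uniqP <- : uniq [seq (a.1.1, a.1.2) | a : triple v <- s].
  exact: max_card.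
rewrite map_inj_in_uniq ?(map_uniq uniq_s) // => -[[x y] z] [[x' y'] z'].
move=> /block_listP Bz /block_listP Bz' [eq_x eq_y].
by rewrite -{}eq_x -{}eq_y in Bz' *; congr (_, _, _); exact: (sts_third stsB Bz Bz').
Qed.

(** The table starts right after the input: two header cells, [v] and the number of blocks, then
    three cells per block. *)
Definition table_base : nat := (3 * size s).+2.

(** The bound on all entries, filled or not, is what makes every later lookup return a point. *)
Definition correct_table (filled : 'I_v -> 'I_v -> Prop) (M : nat -> nat) : Prop :=
  [/\ forall a, a < table_base -> M a = nth 0 (sts_input s) a,
      forall x y : 'I_v, M (cell v table_base x y) < v
    & forall x y z, [set x; y; z] \in B -> filled x y ->
        M (cell v table_base x y) = z].

Lemma correct_table_upd (filled : 'I_v -> 'I_v -> Prop) M (i j k : 'I_v) :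
  [set i; j; k] \in B -> correct_table filled M ->
  correct_table (fun x y => filled x y \/ (x = i /\ y = j))
    (upd M (cell v table_base i j) k).
Proof.
move=> Bijk [low small correct]; split.
- move=> a lt_a; rewrite /upd ifN ?low // neq_ltn.
  by apply/orP; left; apply: leq_trans lt_a _; apply: leq_addl.
- by move=> x y; rewrite /upd; case: ifP.
move=> x y z Bxyz fill; rewrite /upd; case: eqP => [/cell_inj [eq_x eq_y]|neq].
  by rewrite {}eq_x {}eq_y in Bxyz; rewrite (sts_third stsB Bxyz Bijk).
by apply: correct => //; case: fill => // -[eq_x eq_y]; rewrite eq_x eq_y in neq.
Qed.

Definition table_inv (rho : reg -> nat) (filled : 'I_v -> 'I_v -> Prop)
    (st : state) : Prop :=
  [/\ forall r, r != r_addr -> regs st r = rho r, outp st = [::]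
    & correct_table filled (mem st)].

Lemma ok_put_table W rho filled (i j k : 'I_v) (x y z : reg) st :
  v * v + table_base <= W -> rho r_v = v -> rho r_base = table_base ->
  x != r_addr -> y != r_addr -> z != r_addr ->
  rho x = i -> rho y = j -> rho z = k -> [set i; j; k] \in B ->
  table_inv rho filled st ->
  ok W (put x y z) st
    (table_inv rho (fun a b => filled a b \/ (a = i /\ b = j))).
Proof.
move=> leW rho_v rho_b nx ny nz rx ry rz Bijk [reg_st out_st tab_st].
apply: ok_weaken (ok_put (i := i) (j := j) (k := k) leW _ _ ny nz _ _ _) _;
  rewrite ?reg_st // => s' [mem' out' reg'].
split; rewrite ?out' ?mem' //; first by move=> r nr; rewrite reg' ?reg_st.
exact: correct_table_upd.
Qed.

Definition table_body : prog :=
  Seq (Seq (Fetch r_x r_ptr) (Seq (Op Add r_ptr r_ptr r_one)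
      (Seq (Fetch r_y r_ptr) (Seq (Op Add r_ptr r_ptr r_one)
      (Seq (Fetch r_z r_ptr) (Op Add r_ptr r_ptr r_one))))))
    (Seq (put r_x r_y r_z) (Seq (put r_x r_z r_y) (Seq (put r_y r_x r_z)
      (Seq (put r_y r_z r_x) (Seq (put r_z r_x r_y) (put r_z r_y r_x)))))).

Definition loop_inv (i : nat) (st : state) : Prop :=
  [/\ [/\ regs st r_zero = 0, regs st r_one = 1, regs st r_v = v
        & regs st r_base = table_base],
      regs st r_ptr = (3 * i).+2, outp st = [::] &
      correct_table
        (fun x y => exists2 a, a \in take i s &
           (x \in block_of a) && (y \in block_of a)) (mem st)].

Lemma ok_table_body W i st : v * v + table_base <= W -> i < size s ->
  loop_inv i st -> ok W table_body st (loop_inv i.+1).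
Proof.
move=> leW lt_i [[reg0 reg1 reg2 reg3] reg_ptr out_st tab].
have a0 : triple v by case: (s) lt_i.
have [low small _] := tab.
have tri := nth_triple_codes a0 lt_i.
have low3 j : j < 3 ->
    mem st (j + (3 * i).+2) = nth 0 (triple_code (nth a0 s i)) j.
  move=> lt_j; rewrite low; first by rewrite -tri // !addnS /= addnC.
  by rewrite /table_base; lia.
have Ba : block_of (nth a0 s i) \in B by apply: block_listP; apply: mem_nth.
case def_a: (nth a0 s i) Ba low3 => [[x y] z] /= Ba low3; rewrite /block_of /= in Ba.
have lowx := low3 0 isT; have lowy := low3 1 isT; have lowz := low3 2 isT.
rewrite /= add0n add1n add2n in lowx lowy lowz.
(* The pointer ends at most at [table_base]; as the table has at least one cell, this value is
   strictly below [W]. *)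
have v_gt0 : 0 < v := leq_ltn_trans (leq0n x) (ltn_ord x).
have ltW : (3 * i).+4.+1 < W.
  by move: leW; rewrite /table_base; move: (leq_mul v_gt0 v_gt0); lia.
apply: ok_seq; apply: ok_seq; apply: ok_fetch => /=.
apply: ok_seq; apply: ok_op => /=; rewrite /upd /= reg1 reg_ptr; first by lia.
apply: ok_seq; apply: ok_fetch => /=.
apply: ok_seq; apply: ok_op => /=; rewrite /upd /= reg1; first by lia.
apply: ok_seq; apply: ok_fetch => /=.
apply: ok_op => /=; rewrite /upd /= reg1; first by lia.
set st1 := set_reg _ _ _.
have inv1 : table_inv (regs st1)
    (fun x y => exists2 a, a \in take i s &
       (x \in block_of a) && (y \in block_of a)) st1 by [].
rewrite !addn1 in st1 inv1 *.
have st1x : regs st1 r_x = x by rewrite /st1 /= /upd /=.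
have st1y : regs st1 r_y = y by rewrite /st1 /= /upd /=.
have st1z : regs st1 r_z = z by rewrite /st1 /= /upd /=.
have st1v : regs st1 r_v = v by rewrite /st1 /= /upd /=.
have st1b : regs st1 r_base = table_base by rewrite /st1 /= /upd /=.
have [p1 p2 p3 p4 p5] := perms_block x y z.
apply: ok_seq; apply: ok_weaken (ok_put_table leW st1v st1b _ _ _ st1x st1y st1z _ inv1) _
  => // st2 inv2.
apply: ok_seq; apply: ok_weaken (ok_put_table leW st1v st1b _ _ _ st1x st1z st1y _ inv2) _;
  rewrite ?p1 // => st3 inv3.
apply: ok_seq; apply: ok_weaken (ok_put_table leW st1v st1b _ _ _ st1y st1x st1z _ inv3) _;
  rewrite ?p2 // => st4 inv4.
apply: ok_seq; apply: ok_weaken (ok_put_table leW st1v st1b _ _ _ st1y st1z st1x _ inv4) _;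
  rewrite ?p3 // => st5 inv5.
apply: ok_seq; apply: ok_weaken (ok_put_table leW st1v st1b _ _ _ st1z st1x st1y _ inv5) _;
  rewrite ?p4 // => st6 inv6.
apply: ok_weaken (ok_put_table leW st1v st1b _ _ _ st1z st1y st1x _ inv6) _;
  rewrite ?p5 // => st7 [reg7 out7 [low7 small7 correct7]].
split; [by split; rewrite reg7 | | by [] | split=> //].
  by rewrite reg7 // /st1 /= /upd /= mulnS.
move=> x' y' z' B'; rewrite (take_nth a0) // => -[a].
rewrite mem_rcons inE => /orP[/eqP->|a_s]; last first.
  by move=> a_xy; apply: correct7 => //; do 6!left; exists a.
rewrite def_a => /andP[]; rewrite !inE /= => x'_in y'_in.
apply: correct7 => //.
(* Of the nine positions of [(x', y')] in the block the diagonal ones are excluded, and the other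
   six are the six cells just written. *)
have neq_xy : x' != y'.
  apply: contraTneq B' => ->; apply/negP=> /stsB.1.
  by rewrite setUid cards2; case: eqP.
move: neq_xy; case/orP: x'_in => [/orP[]|] /eqP->;
  case/orP: y'_in => [/orP[]|] /eqP->; rewrite ?eqxx // => _; tauto.
Qed.

(** Cell 1 holds the number of blocks; [table_base] is computed from it by additions, with [r_addr]
    as scratch. Blocks start at cell 2. *)
Definition table_prog : prog :=
  Seq (Const r_one 1) (Seq (Fetch r_base r_one)
  (Seq (Op Add r_addr r_base r_base) (Seq (Op Add r_base r_addr r_base)
  (Seq (Op Add r_base r_base r_one) (Seq (Op Add r_base r_base r_one)
  (Seq (Const r_ptr 2) (While CmpLt r_ptr r_base table_body))))))).

Lemma runs_in_table_prog W st : v * v + table_base < W ->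
  regs st r_zero = 0 -> regs st r_v = v -> outp st = [::] ->
  mem st = nth 0 (sts_input s) ->
  runs_in W table_prog st (size s * (cost table_body).+1 + 8) (fun st' =>
    outp st' = [::] /\
    exists (third : 'I_v -> 'I_v -> 'I_v) (M : nat -> nat),
    [/\ forall x y z, [set x; y; z] \in B -> third x y = z,
        forall x y : 'I_v, M (cell v table_base x y) = third x y
      & ready v table_base M st']).
Proof.
move=> leW reg0 reg2 out_st mem_st.
have leW2 : table_base < W by lia.
rewrite /table_base in leW2.
(* Seven instructions precede the loop; the eighth unit is its failing test. *)
rewrite addnC -[8]/(1 + (1 + (1 + (1 + (1 + (1 + (1 + 1))))))) -!addnA.
apply: runs_in_seq; apply: ok_const => /=; first by lia.
apply: runs_in_seq; apply: ok_fetch => /=; rewrite mem_st /upd /=.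
apply: runs_in_seq; apply: ok_op => /=; rewrite /upd /=; first by lia.
apply: runs_in_seq; apply: ok_op => /=; rewrite /upd /=; first by lia.
apply: runs_in_seq; apply: ok_op => /=; rewrite /upd /=; first by lia.
apply: runs_in_seq; apply: ok_op => /=; rewrite /upd /=; first by lia.
apply: runs_in_seq; apply: ok_const => /=; rewrite /upd /=; first by lia.
set st1 := set_reg _ _ _.
apply: runs_in_weaken (@runs_in_while _ _ _ _ _ (cost table_body) (size s) loop_inv _ _ _ _) _ _.
- move=> i s1 [[_ _ _ ->] -> _ _]; rewrite /= /table_base; lia.
- by move=> i s1; apply: ok_table_body; apply: ltnW.
- split=> //; first split; rewrite /= /upd //=.
    by rewrite /table_base; lia.
  rewrite mem_st; split=> // [x y|x y z _ []]; last by rewrite take0.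
  (* Cells beyond the input hold 0, and 0 is below [v] because the point [x] exists. *)
  rewrite nth_default ?(leq_ltn_trans _ (ltn_ord x)) //=.
  by rewrite size_triple_codes; apply: leq_addl.
- exact: leqnn.
move=> s' [[r0 r1 r2 r3] _ out' [_ small correct]]; split=> //.
(* [third] is read off the final memory, so it agrees with the table on the diagonal too. *)
exists (fun x y => Ordinal (small x y)), (mem s'); split=> // x y z Bxyz.
apply: val_inj; apply: (correct _ _ _ Bxyz); rewrite take_size.
have : [set x; y; z] \in map (@block_of v) s by rewrite listB.2.
by case/mapP=> a a_s def_a; exists a; rewrite // -def_a !inE !eqxx !orbT.
Qed.

End Table.

(** * The program for one configuration *)

Definition horner_code (v : nat) (l : seq nat) : nat :=
  foldl (fun acc x => acc * v + x) 0 l.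

(** The last base-[v] digit is the remainder modulo [v]; cancelling it leaves shorter numerals of
    equal value. *)
Lemma horner_code_inj v (l l' : seq nat) :
  size l = size l' -> all (fun x => x < v) l -> all (fun x => x < v) l' ->
  horner_code v l = horner_code v l' -> l = l'.
Proof.
elim/last_ind: l l' => [|l x IHl] l'; first by move/esym/size0nil.
case/lastP: l' => [|l' x']; first by rewrite size_rcons.
rewrite !size_rcons !all_rcons /horner_code !foldl_rcons => -[eq_sz].
case/andP=> lt_x lt_l /andP[lt_x' lt_l'] eq_c.
have eq_x : x = x'.
  by have := congr1 (modn^~ v) eq_c; rewrite !modnMDl !modn_small.
rewrite eq_x; congr rcons; apply: IHl => //; move/eqP: eq_c.
by rewrite eq_x eqn_add2r eqn_pmul2r ?(leq_ltn_trans _ lt_x) // => /eqP.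
Qed.

Definition ffun_upd (U : finType) (A : eqType) (e : {ffun U -> A}) u x :
    {ffun U -> A} :=
  [ffun w => if w == u then x else e w].

(** The order is that of nested loops with the first point of [us] outermost, so the output of
    [nest] is literally the concatenation along this list. *)
Fixpoint reassignments (U : finType) v (us : seq U) (e : {ffun U -> 'I_v}) :
    seq {ffun U -> 'I_v} :=
  if us is u :: us' then
    flatten [seq reassignments us' (ffun_upd e u x) | x <- enum 'I_v]
  else [:: e].

Section PatternProgram.

Variables (U : finType) (gens : seq U) (steps : seq (U * (U * U))).
Variables (ltr : seq (U * U * U)) (auts : seq {ffun U -> U}).

Definition points : seq U := gens ++ map fst steps.

Hypothesis all_points : forall u, u \in points.

Definition preg (u : U) : reg := point_reg (index u points).

Lemma preg_inj : injective preg.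
Proof.
by move=> u w /addnI eq_i; rewrite -(nth_index u (all_points u)) eq_i nth_index.
Qed.

Lemma preg_eq u w : (preg u == preg w) = (u == w).
Proof. exact: inj_eq preg_inj u w. Qed.

Lemma preg_neq u r : r < 12 -> (preg u == r) = false.
Proof. by move=> lt_r; apply/negP=> /eqP def_r; move: lt_r; rewrite -def_r ltnNge leq_addr. Qed.

Definition step_prog (st : U * (U * U)) : prog :=
  lookup (preg st.1) (preg st.2.1) (preg st.2.2).

Definition fail_flag : prog := Const r_flag 0.

Definition inj_test (p : U * U) : prog :=
  If CmpEq (preg p.1) (preg p.2) fail_flag Skip.

Definition line_test (l : U * U * U) : prog :=
  Seq (lookup r_x (preg l.1.1) (preg l.1.2))
    (If CmpEq r_x (preg l.2) Skip fail_flag).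

Definition horner_prog (r : reg) (f : U -> U) (us : seq U) : prog :=
  seqs (fun u => Seq (Op Mul r r r_v) (Op Add r r (preg (f u)))) us.

Definition aut_test (f : {ffun U -> U}) : prog :=
  Seq (Const r_code 0) (Seq (horner_prog r_code id points)
    (Seq (Const r_code' 0) (Seq (horner_prog r_code' f points)
      (If CmpLt r_code' r_code fail_flag Skip)))).

Definition output_line (l : U * U * U) : prog :=
  Seq (Output (preg l.1.1)) (Seq (Output (preg l.1.2)) (Output (preg l.2))).

Definition output_prog : prog :=
  If CmpEq r_flag r_one
    (Seq (Const r_x (size ltr)) (Seq (Output r_x) (seqs output_line ltr))) Skip.

Definition distinct_pairs : seq (U * U) := [seq p <- enum {: U * U} | p.1 != p.2].

Definition body_prog : prog :=
  Seq (seqs step_prog steps) (Seq (Const r_flag 1)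
    (Seq (seqs inj_test distinct_pairs) (Seq (seqs line_test ltr)
      (Seq (seqs aut_test auts) output_prog)))).

Definition nest (us : seq U) : prog :=
  foldr (fun u p => Seq (Const (preg u) 0)
    (While CmpLt (preg u) r_v (Seq p (Op Add (preg u) (preg u) r_one))))
    body_prog us.

(** * Output and running time of the program for one configuration *)

Section Semantics.

Variables (W v base : nat) (M : nat -> nat) (third : 'I_v -> 'I_v -> 'I_v).
Hypothesis M_third : forall x y : 'I_v, M (cell v base x y) = third x y.
Hypothesis leW_cell : v * v + base <= W.
Hypothesis leW_code : v ^ size points <= W.
Hypothesis ltW_lines : size ltr < W.
Hypothesis ltW_1 : 1 < W.

Implicit Types (e g : {ffun U -> 'I_v}) (s : state).

Definition agree (G : seq U) e s : Prop :=
  {in G, forall u, regs s (preg u) = e u}.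

Definition do_step e (st : U * (U * U)) : {ffun U -> 'I_v} :=
  ffun_upd e st.1 (third (e st.2.1) (e st.2.2)).

Definition extend_by_steps g : {ffun U -> 'I_v} := foldl do_step g steps.

(** [G] collects the points that already have a value. The line condition is what makes the
    looked-up point the value of any embedding. *)
Fixpoint wf_steps (L : {set {set U}}) (G : seq U) (sts : seq (U * (U * U))) : bool :=
  if sts is st :: sts' then
    [&& st.2.1 \in G, st.2.2 \in G, [set st.2.1; st.2.2; st.1] \in L
      & wf_steps L (st.1 :: G) sts']
  else true.

Lemma ready_same s s' : ready v base M s -> mem s' = mem s ->
  (forall r, r < 4 -> regs s' r = regs s r) -> ready v base M s'.
Proof. by case=> r0 r1 r2 r3 mM mm' rr; split; rewrite ?mm' ?rr. Qed.

Lemma ok_steps L G sts e s o :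
  wf_steps L G sts -> ready v base M s -> agree G e s -> outp s = o ->
  ok W (seqs step_prog sts) s (fun s' => [/\ ready v base M s',
    agree (map fst sts ++ G) (foldl do_step e sts) s' & outp s' = o]).
Proof.
elim: sts G e s => [|[u [a b]] sts IHsts] G e s /=; first by move=> *; apply: ok_skip.
case/and4P=> Ga Gb _ wf rs ag out_s; apply: ok_seq.
have [_ _ s_v s_b s_M] := rs.
apply: ok_weaken (ok_lookup (preg u) leW_cell s_v s_b _ (ag _ Ga) (ag _ Gb)) _.
  by rewrite preg_neq.
move=> s1 /= [mem1 out1 reg_u reg1].
have ag1 : agree (u :: G) (do_step e (u, (a, b))) s1.
  move=> w; rewrite /do_step ffunE inE /=; case: eqVneq => [->|neq_wu] /= Gw.
    by rewrite reg_u s_M M_third.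
  by rewrite reg1 ?preg_eq ?preg_neq ?ag.
have rs1 : ready v base M s1.
  apply: ready_same rs mem1 _ => r lt_r; apply: reg1; first by case: eqP lt_r => // ->.
  by rewrite eq_sym preg_neq // (leq_trans lt_r).
apply: ok_weaken (IHsts _ _ _ wf rs1 ag1 (etrans out1 out_s)) _ => s2 [rs2 ag2 out2].
by split=> // w w_in; apply: ag2; move: w_in; rewrite inE !mem_cat inE orbCA orbA.
Qed.

Definition test_inv e o (fl : bool) s : Prop :=
  [/\ ready v base M s, forall u, regs s (preg u) = e u, regs s r_flag = fl :> nat
    & outp s = o].

Lemma test_inv_same e o fl s s' : test_inv e o fl s -> mem s' = mem s ->
  outp s' = outp s -> (forall r, (r <= r_flag) || (12 <= r) -> regs s' r = regs s r) ->
  test_inv e o fl s'.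
Proof.
case=> rs pt flg out_s mem' out' reg'; split; rewrite ?out' //.
- by apply: ready_same rs mem' _ => r lt_r; rewrite reg' // ltnW.
- by move=> u; rewrite reg' ?pt // leq_addr orbT.
by rewrite reg'.
Qed.

Lemma ok_fail_flag e o fl s :
  test_inv e o fl s -> ok W fail_flag s (test_inv e o false).
Proof.
case=> rs pt flg out_s; apply: ok_const; first exact: ltnW.
by split.
Qed.

Lemma ok_tests (A : eqType) (p : A -> prog) (c : pred A) (xs : seq A) e o fl s :
  (forall x b s1, test_inv e o b s1 -> ok W (p x) s1 (test_inv e o (b && c x))) ->
  test_inv e o fl s -> ok W (seqs p xs) s (test_inv e o (fl && all c xs)).
Proof.
move=> tests inv_s.
have -> : fl && all c xs = foldl (fun b x => b && c x) fl xs.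
  by elim: xs fl {inv_s} => [|x xs IHxs] fl /=; rewrite ?andbT // -IHxs andbA.
by apply: (@ok_seqs _ _ _ p xs (fun b x => b && c x)) inv_s => x _ b s1; apply: tests.
Qed.

Lemma ok_inj_test e o p b s : test_inv e o b s ->
  ok W (inj_test p) s (test_inv e o (b && (e p.1 != e p.2))).
Proof.
move=> inv_s; have [_ pt _ _] := inv_s.
apply: ok_if; rewrite /= !pt val_eqE => cmp; last by apply: ok_skip; rewrite cmp andbT.
by rewrite cmp andbF; apply: ok_fail_flag inv_s.
Qed.

Lemma ok_line_test e o l b s : test_inv e o b s ->
  ok W (line_test l) s
    (test_inv e o (b && (third (e l.1.1) (e l.1.2) == e l.2))).
Proof.
move=> inv_s; have [[_ _ s_v s_b s_M] pt _ _] := inv_s; apply: ok_seq.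
apply: ok_weaken (ok_lookup r_x leW_cell s_v s_b _ (pt _) (pt _)) _.
  by rewrite preg_neq.
move=> s1 [mem1 out1 reg_x reg1].
have inv1 : test_inv e o b s1.
  apply: test_inv_same inv_s mem1 out1 _ => r r_ok.
  by apply: reg1; case: eqP r_ok => // ->.
have [_ pt1 _ _] := inv1.
apply: ok_if; rewrite /= reg_x pt1 s_M M_third val_eqE => cmp.
  by apply: ok_skip; rewrite cmp andbT.
by rewrite (negPf cmp) andbF; apply: ok_fail_flag inv1.
Qed.

Lemma ok_horner e r f us acc s : r < 12 -> r != r_v ->
  (forall u, regs s (preg u) = e u) -> regs s r_v = v -> regs s r = acc ->
  acc.+1 * v ^ size us <= W ->
  ok W (horner_prog r f us) s (fun s' => same_except r s s' /\
    regs s' r = foldl (fun a x => a * v + x) acc [seq val (e (f u)) | u <- us]).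
Proof.
move=> lt_r neq_r; elim: us acc s => [|u us IHus] acc s pt s_v s_r leW /=.
  by apply: ok_skip; split.
have lt_u := ltn_ord (e (f u)).
have leW1 : (acc * v + e (f u)).+1 * v ^ size us <= W.
  apply: leq_trans leW; rewrite /= expnS mulnA leq_mul2r; apply/orP; right.
  by rewrite mulSn; lia.
have ltW1 : acc * v + e (f u) < W.
  apply: leq_trans leW1; apply: leq_pmulr.
  by rewrite expn_gt0 (leq_ltn_trans _ lt_u).
apply: ok_seq; apply: ok_seq; apply: ok_op => /=; rewrite s_v s_r; first by lia.
apply: ok_op; rewrite /= /upd eqxx preg_neq // pt //.
set s1 := set_reg _ _ _.
have same1 r' : r' != r -> regs s1 r' = regs s r'.
  by move=> /negPf neq'; rewrite /s1 /= /upd neq'.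
apply: ok_weaken (IHus (acc * v + e (f u)) s1 _ _ _ leW1) _.
- by move=> w; rewrite same1 ?preg_neq.
- by rewrite same1 1?eq_sym.
- by rewrite /s1 /= /upd eqxx.
move=> s2 [[mem2 out2 reg2] ->]; split=> //; split; rewrite ?mem2 ?out2 //.
by move=> r' neq'; rewrite reg2 ?same1.
Qed.

Definition emb_code e (f : U -> U) : nat :=
  horner_code v [seq val (e (f u)) | u <- points].

Lemma ok_aut_test e o f b s : test_inv e o b s ->
  ok W (aut_test f) s (test_inv e o (b && (emb_code e id <= emb_code e f))).
Proof.
move=> inv_s; have [[_ _ s_v _ _] pt _ _] := inv_s.
apply: ok_seq; apply: ok_const; first exact: ltnW.
apply: ok_seq; set s1 := set_reg _ _ _.
have pt1 u : regs s1 (preg u) = e u by rewrite /= /upd preg_neq.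
apply: ok_weaken (@ok_horner e r_code id points 0 s1 isT isT pt1 _ _ _) _ => //.
  by rewrite mul1n.
move=> s2 [[mem2 out2 reg2] code2].
apply: ok_seq; apply: ok_const; first exact: ltnW.
apply: ok_seq; set s3 := set_reg _ _ _.
have pt3 u : regs s3 (preg u) = e u.
  by rewrite /= /upd preg_neq // reg2 ?preg_neq.
apply: ok_weaken (@ok_horner e r_code' f points 0 s3 isT isT pt3 _ _ _) _ => //.
- by rewrite /= /upd /= reg2.
- by rewrite mul1n.
move=> s4 [[mem4 out4 reg4] code4].
have inv4 : test_inv e o b s4.
  apply: test_inv_same inv_s _ _ _; rewrite ?mem4 ?out4 //= ?mem2 ?out2 //= => r r_ok.
  have [n6 n7] : r != r_code /\ r != r_code' by split; case: eqP r_ok => // ->.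
  by rewrite reg4 //= /upd (negPf n7) reg2 //= /upd (negPf n6).
have code4' : regs s4 r_code = emb_code e id by rewrite reg4 //= /upd /= code2.
apply: ok_if; rewrite /= code4 code4' => cmp; last first.
  by apply: ok_skip; rewrite leqNgt cmp andbT.
by rewrite leqNgt cmp andbF; apply: ok_fail_flag inv4.
Qed.

Definition is_embedding e : bool :=
  all (fun p : U * U => e p.1 != e p.2) distinct_pairs &&
  all (fun l : U * U * U => third (e l.1.1) (e l.1.2) == e l.2) ltr.

Definition accepted e : bool :=
  is_embedding e && all (fun f : {ffun U -> U} => emb_code e id <= emb_code e f) auts.

Definition image_lines e : seq (triple v) :=
  [seq (e l.1.1, e l.1.2, e l.2) | l <- ltr].

Definition found g : seq (seq (triple v)) :=
  let e := extend_by_steps g in if accepted e then [:: image_lines e] else [::].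

Definition output_of (D : seq (seq (triple v))) : seq nat :=
  flatten (map (@blocks_code v) D).

Lemma ok_output_prog e o b s : test_inv e o b s ->
  ok W output_prog s
    (test_inv e (o ++ output_of (if b then [:: image_lines e] else [::])) b).
Proof.
move=> inv_s; have [rs pt flg out_s] := inv_s.
apply: ok_if; rewrite /= flg; case: (rs) => _ -> _ _ _; case: b flg inv_s => // flg inv_s _;
  last by apply: ok_skip; rewrite cats0.
apply: ok_seq; apply: ok_const => //; apply: ok_seq; apply: ok_output.
set s1 := State _ _ _.
have inv1 : test_inv e (rcons o (size ltr)) true s1.
  by split; rewrite //= out_s.
pose add_line (o1 : seq nat) (l : U * U * U) :=
  o1 ++ triple_code (e l.1.1, e l.1.2, e l.2).
apply: ok_weaken (@ok_seqs _ _ _ _ ltr add_line (fun o1 => test_inv e o1 true)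
  _ _ _ inv1) _ => [l _ o1 s2 [rs2 pt2 flg2 out2]|s2].
  apply: ok_seq; apply: ok_output; apply: ok_seq; apply: ok_output.
  apply: ok_output; split=> //=.
  by rewrite !pt2 out2 /add_line -!cats1 -!catA.
suff -> : foldl add_line (rcons o (size ltr)) ltr
    = o ++ output_of [:: image_lines e] by [].
rewrite /output_of /= /blocks_code /image_lines size_map cats0 -cat_rcons.
elim: (ltr) (rcons o _) => [|l ls IHl] o1 /=; first by rewrite cats0.
by rewrite IHl /add_line -catA.
Qed.

(** The condition on [gens] says that the steps leave the generator registers alone, so the
    surrounding loops find their counters unchanged. *)
Lemma ok_body L g s : wf_steps L gens steps ->
  {in gens, extend_by_steps g =1 g} -> ready v base M s -> agree gens g s ->
  ok W body_prog s (fun s' => [/\ ready v base M s', agree gens g s'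
    & outp s' = outp s ++ output_of (found g)]).
Proof.
move=> wf ext_g rs ag; apply: ok_seq.
apply: ok_weaken (ok_steps wf rs ag erefl) _ => s1 [rs1 ag1 out1].
apply: ok_seq; apply: ok_const => //; apply: ok_seq; set s2 := set_reg _ _ _.
have inv2 : test_inv (extend_by_steps g) (outp s) true s2.
  split=> // u; rewrite /= /upd preg_neq // ag1 //.
  by have := all_points u; rewrite !mem_cat orbC.
apply: ok_weaken (ok_tests distinct_pairs (@ok_inj_test _ _) inv2) _ => s3 inv3.
apply: ok_seq; apply: ok_weaken (ok_tests ltr (@ok_line_test _ _) inv3) _ => s4 inv4.
apply: ok_seq; apply: ok_weaken (ok_tests auts (@ok_aut_test _ _) inv4) _ => s5 inv5.
apply: ok_weaken (ok_output_prog inv5) _ => s6 [rs6 pt6 _ out6].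
by split=> // u gen_u; rewrite pt6 ext_g.
Qed.

(** [G] holds the generators fixed by the loops already entered, [us] those still to be looped
    over. *)
Lemma runs_in_nest c us G g s :
  v < W ->
  (forall g1 s1, ready v base M s1 -> agree gens g1 s1 ->
    runs_in W body_prog s1 c (fun s' => [/\ ready v base M s', agree gens g1 s'
      & outp s' = outp s1 ++ output_of (found g1)])) ->
  us ++ G =i gens -> uniq (us ++ G) -> ready v base M s -> agree G g s ->
  runs_in W (nest us) s ((c + 2 * size us) * v.+1 ^ size us)
    (fun s' => [/\ ready v base M s', agree G g s'
      & outp s' = outp s ++ output_of (flatten (map found (reassignments us g)))]).
Proof.
clear leW_cell leW_code ltW_lines.
move=> ltW body; elim: us G g s => [|u us IHus] G g s def_gens uniq_us rs ag.
  rewrite addn0 muln1; apply: runs_in_weaken (body g s rs _) _ _ => //.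
    by move=> u; rewrite -def_gens; apply: ag.
  move=> s' [rs' ag' out']; split=> //; last by rewrite /= cats0.
  by move=> u Gu; apply: ag'; rewrite -def_gens.
set T := (c + 2 * size us) * v.+1 ^ size us in IHus.
pose Inv i s1 := [/\ ready v base M s1, agree G g s1, regs s1 (preg u) = i
  & outp s1 = outp s ++ output_of (flatten (map found
      (flatten [seq reassignments us (ffun_upd g u x) | x <- take i (enum 'I_v)])))].
have notGu : u \notin G by move: uniq_us; rewrite /= mem_cat negb_or => /andP[/andP[]].
have upd_u s1 i :
    (forall r, r != preg u -> regs (set_reg s1 (preg u) i) r = regs s1 r).
  by move=> r /negPf neq_r; rewrite /= /upd neq_r.
have low_preg r : r < 4 -> r != preg u.
  by move=> lt_r; rewrite eq_sym preg_neq // (leq_trans lt_r).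
have G_preg w : w \in G -> preg w != preg u.
  by move=> Gw; rewrite preg_eq; apply: contraTneq Gw => ->.
apply: (@runs_in_weaken _ _ _ (1 + (v * (T + 1).+1).+1) _ (Inv v)); last first.
- by move=> s' [rs' ag' _ ->]; rewrite take_oversize // size_enum_ord.
(* One more level costs [v * (T + 2) + 2]. The base [v.+1] instead of [v] gives room for [v * T],
   and the coefficient growing by 2 pays the overhead [2 * v.+1]. *)
- have : v.+1 <= v.+1 ^ (size us).+1 by rewrite expnS leq_pmulr // expn_gt0.
  rewrite /T /= expnS; set X := v.+1 ^ size us; nia.
apply: runs_in_seq; apply: ok_const; first exact: ltnW.
apply: runs_in_while.
- by move=> i s1 [[_ _ s_v _ _] _ s_u _]; rewrite /= s_u s_v.
- move=> i s1 lt_i [rs1 ag1 s_u out1]; apply: runs_in_seq.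
  pose x := Ordinal lt_i.
  have agx : agree (u :: G) (ffun_upd g u x) s1.
    move=> w; rewrite inE ffunE; case: eqVneq => [-> _|_ /= Gw]; first by rewrite s_u.
    exact: ag1.
  apply: runs_in_weaken (IHus _ _ _ _ _ rs1 agx) _ _ => //.
  + by move=> w; rewrite -def_gens mem_cat !inE mem_cat orbCA.
  + by rewrite -cat_rcons -cats1 -catA uniq_catCA /= in uniq_us *.
  move=> s2 [rs2 ag2 out2]; have [_ s2_1 _ _ _] := rs2.
  have s2_u : regs s2 (preg u) = i by rewrite ag2 ?mem_head // ffunE eqxx.
  apply: ok_op; rewrite /= s2_1 s2_u addn1; first exact: leq_ltn_trans ltW.
  split.
  + by apply: ready_same rs2 _ _ => // r /low_preg; apply: upd_u.
  + move=> w Gw; rewrite upd_u ?G_preg // ag2 ?inE ?Gw ?orbT // ffunE.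
    by rewrite -preg_eq (negPf (G_preg w Gw)).
  + by rewrite /= /upd eqxx.
  have lt_i' : i < size (enum 'I_v) by rewrite size_enum_ord.
  rewrite (take_nth x) //= -[nth x _ i]/(nth x (enum 'I_v) x) nth_ord_enum.
  rewrite map_rcons flatten_rcons map_cat flatten_cat.
  by rewrite /output_of map_cat flatten_cat catA -/(output_of _) -out1.
split.
- by apply: ready_same rs _ _ => // r /low_preg; apply: upd_u.
- by move=> w Gw; rewrite upd_u ?G_preg ?ag.
- by rewrite /= /upd eqxx.
by rewrite take0 /= cats0.
Qed.

End Semantics.
End PatternProgram.

(** * Embeddings of a configuration in a Steiner triple system *)

Definition triple_set (V : finType) (a : V * V * V) : {set V} :=
  [set a.1.1; a.1.2; a.2].

Definition embed_lines (U V : finType) (L : {set {set U}}) (f : U -> V) :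
    {set {set V}} :=
  [set f @: (b : {set U}) | b in L].

Definition automorphisms (U : finType) (L : {set {set U}}) : seq {ffun U -> U} :=
  [seq f : {ffun U -> U} <- enum {ffun U -> U} | injectiveb f & embed_lines L f == L].

Definition lines_of v (a : seq (triple v)) : {set {set 'I_v}} :=
  [set b in map (@block_of v) a].

(** A listing before it is encoded as a stream of numbers, so that listings can be combined by
    concatenation. *)
Definition lists v (P : {set {set 'I_v}} -> Prop) (ss : seq (seq (triple v))) : Prop :=
  [/\ uniq (map (@lines_of v) ss), forall D, D \in map (@lines_of v) ss <-> P D
    & {in ss, forall a, uniq (map (@block_of v) a)}].

Lemma imset_triple (U V : finType) (f : U -> V) (a : U * U * U) :
  f @: triple_set a = [set f a.1.1; f a.1.2; f a.2].
Proof. by rewrite /triple_set !imsetU !imset_set1. Qed.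

Lemma reassignmentsP (U : finType) v (us : seq U) (e g : {ffun U -> 'I_v}) :
  reflect (forall u, u \notin us -> g u = e u) (g \in reassignments us e).
Proof.
elim: us e => [|u us IHus] e /=.
  by rewrite inE; apply: (iffP eqP) => [-> //|eq_g]; apply/ffunP=> u; apply: eq_g.
apply: (iffP flatten_mapP) => [[x _ /IHus g_in] w | eq_g].
  by rewrite inE negb_or => /andP[/negPf neq_w /g_in]; rewrite ffunE neq_w.
exists (g u); first by rewrite mem_enum.
apply/IHus=> w w_us; rewrite ffunE; case: eqVneq => [-> //|neq_w].
by apply: eq_g; rewrite inE negb_or neq_w.
Qed.

Lemma reassignments_uniq (U : finType) v (us : seq U) (e : {ffun U -> 'I_v}) :
  uniq us -> uniq (reassignments us e).
Proof.
elim: us e => [//|u us IHus] e /= /andP[us_u uniq_us].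
have := enum_uniq 'I_v; elim: (enum 'I_v) => [//|x xs IHxs] /= /andP[xs_x uniq_xs].
rewrite cat_uniq IHus // IHxs // andbT; apply/hasPn=> g /flatten_mapP[y xs_y].
move=> /reassignmentsP/(_ u us_u) gy; apply/negP=> /reassignmentsP/(_ u us_u).
by rewrite gy !ffunE eqxx => eq_xy; rewrite -eq_xy xs_y in xs_x.
Qed.

Section PatternListing.

Variables (U : finType) (L : {set {set U}}) (gens : seq U).
Variables (steps : seq (U * (U * U))) (ltr : seq (U * U * U)).

Local Notation pts := (points gens steps).
Local Notation auts := (automorphisms L).

Hypotheses (all_points : forall u, u \in pts) (uniq_points : uniq pts).
Hypothesis wf : wf_steps L gens steps.
Hypotheses (ltr_uniq : uniq (map (@triple_set U) ltr))
           (ltr_mem : map (@triple_set U) ltr =i L).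
Hypothesis card_lines : forall b, b \in L -> #|b| = 3.
Hypothesis covered : forall u, exists2 b, b \in L & u \in b.

Variables (v : nat) (B : {set {set 'I_v}}) (third : 'I_v -> 'I_v -> 'I_v).
Hypotheses (stsB : is_sts B).
Hypothesis thirdP : forall x y z, [set x; y; z] \in B -> third x y = z.

Implicit Types e f g : {ffun U -> 'I_v}.

Lemma third_block x y : x != y -> [set x; y; third x y] \in B.
Proof.
move=> neq_xy; have card2 : #|[set x; y]| = 2 by rewrite cards2 neq_xy.
have /eqP/cards1P[b def_b] := stsB.2 _ card2.
have : b \in [set b in B | [set x; y] \subset b] by rewrite def_b set11.
rewrite inE => /andP[Bb sub_b]; have /eqP := stsB.1 b Bb.
rewrite (cardsD1 x) (cardsD1 y); rewrite subUset !sub1set in sub_b.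
have /andP[-> b_y] := sub_b; rewrite !inE (eq_sym y) neq_xy b_y !add1n !eqSS.
case/cards1P=> z def_z; suff eq_b : b = [set x; y; z] by rewrite (thirdP (z := z)) -eq_b.
apply/setP=> w; move/setP/(_ w): def_z; rewrite !inE; have [-> _|neq_wx] /= := eqVneq w x.
  by case/andP: sub_b.
by have [->|neq_wy] /= := eqVneq w y; rewrite ?b_y.
Qed.

(** On equal arguments [third] is arbitrary, so a line test means membership in [B] only once
    injectivity is known: then the first two image points are distinct and [third] completes them to
    a block. *)
Lemma is_embeddingP f :
  reflect (injective f /\ embed_lines L f \subset B) (is_embedding ltr third f).
Proof.
have injP : reflect (injective f)
    (all (fun p : U * U => f p.1 != f p.2) (distinct_pairs U)).
  apply: (iffP allP) => [neq_f u w eq_f | inj_f [u w]]; last first.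
    by rewrite mem_filter /= => /andP[neq_uw _]; rewrite (inj_eq inj_f).
  apply/eqP; apply: contraT => neq_uw.
  by have := neq_f (u, w); rewrite mem_filter /= neq_uw mem_enum eq_f eqxx => /(_ isT).
have lineP l : injective f -> l \in ltr ->
    (third (f l.1.1) (f l.1.2) == f l.2) = (f @: triple_set l \in B).
  move=> inj_f ltr_l; rewrite imset_triple; apply/eqP/idP => [<-|/thirdP //].
  apply: third_block; rewrite (inj_eq inj_f).
  have /card_lines : triple_set l \in L by rewrite -ltr_mem map_f.
  apply: contra_eqN => /eqP eq_l; rewrite /triple_set eq_l setUid cards2.
  by case: (l.1.2 == l.2).
apply: (iffP andP) => [[/injP inj_f lines_f] | [inj_f lines_f]]; split=> //.
- apply/subsetP=> _ /imsetP[b Lb ->]; rewrite -ltr_mem in Lb.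
  by case/mapP: Lb => l ltr_l ->; rewrite -lineP // (allP lines_f).
- exact/injP.
apply/allP=> l ltr_l; rewrite lineP //; apply: (subsetP lines_f); apply: imset_f.
by rewrite -ltr_mem map_f.
Qed.

Lemma embed_linesM (f : U -> 'I_v) (h : U -> U) :
  embed_lines L (f \o h) = embed_lines (embed_lines L h) f.
Proof.
by rewrite /embed_lines -imset_comp; apply: eq_imset => b /=; rewrite imset_comp.
Qed.

Lemma emb_code_comp f (h : U -> U) :
  emb_code gens steps f h = emb_code gens steps [ffun u => f (h u)] id.
Proof. by rewrite /emb_code; congr horner_code; apply: eq_map => u; rewrite ffunE. Qed.

Lemma emb_code_inj f g :
  emb_code gens steps f id = emb_code gens steps g id -> f = g.
Proof.
move=> eq_c; have small e : all (fun x => x < v) [seq val (e u) | u <- pts].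
  by apply/allP=> _ /mapP[u _ ->]; apply: ltn_ord.
have /eq_in_map eq_fg := horner_code_inj (etrans (size_map _ _) (esym (size_map _ _)))
  (small f) (small g) eq_c.
by apply/ffunP=> u; apply: val_inj; apply: eq_fg.
Qed.

(* Two embeddings with the same image differ by an automorphism of L. *)
Lemma accepted_inj f g :
  accepted gens steps ltr auts third f -> accepted gens steps ltr auts third g ->
  embed_lines L f = embed_lines L g -> f = g.
Proof.
(* Codes are injective, so by symmetry one inequality between them is enough. *)
suff le_code f1 g1 : accepted gens steps ltr auts third f1 ->
    accepted gens steps ltr auts third g1 -> embed_lines L f1 = embed_lines L g1 ->
    emb_code gens steps f1 id <= emb_code gens steps g1 id.
  by move=> acc_f acc_g eq_im; apply: emb_code_inj; apply/anti_leq; rewrite !le_code.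
move=> /andP[/is_embeddingP[inj_f _] /allP min_f] /andP[/is_embeddingP[inj_g _] _] eq_im.
(* Every point lies on a line, whose image under [g1] is also the image under [f1] of some line.
   Hence [f1] attains all values of [g1], and the automorphism [h] with [f1 \o h = g1] can be chosen
   pointwise. *)
have ex_u u : exists w, g1 u == f1 w.
  have [b Lb b_u] := covered u; have : g1 @: b \in embed_lines L f1.
    by rewrite eq_im imset_f.
  case/imsetP=> b' _ eq_b; have : g1 u \in g1 @: b by rewrite imset_f.
  by rewrite eq_b => /imsetP[w _ ->]; exists w.
pose h := [ffun u => xchoose (ex_u u)].
have f1h u : f1 (h u) = g1 u by rewrite ffunE; apply/esym/eqP/(xchooseP (ex_u u)).
have inj_h : injective h by move=> u w eq_h; apply: inj_g; rewrite -!f1h eq_h.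
have sub_h : embed_lines L h \subset L.
  apply/subsetP=> _ /imsetP[b Lb ->].
  have : g1 @: b \in embed_lines L f1 by rewrite eq_im imset_f.
  case/imsetP=> b' Lb' eq_b; suff -> : h @: b = b' by [].
  apply: (imset_inj inj_f); rewrite -eq_b -imset_comp.
  by apply: eq_imset => u /=; rewrite f1h.
have aut_h : h \in auts.
  rewrite mem_filter mem_enum andbT; apply/andP; split; first exact/injectiveP.
  (* An injective map of points is injective on lines, so by counting [h] maps [L] onto [L]. *)
  by rewrite eqEcard sub_h (card_imset _ (imset_inj inj_h)) leqnn.
suff <- : [ffun u => f1 (h u)] = g1 by rewrite -emb_code_comp; apply: min_f.
by apply/ffunP=> u; rewrite ffunE f1h.
Qed.

(** Take the least code among all injective maps with the same image as [f]. Composition with an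
    automorphism stays in this family, so the minimum passes every automorphism test. *)
Lemma accepted_exists (f : U -> 'I_v) : injective f -> embed_lines L f \subset B ->
  exists2 g, accepted gens steps ltr auts third g & embed_lines L g = embed_lines L f.
Proof.
move=> inj_f sub_f; pose P g := injectiveb g && (embed_lines L g == embed_lines L f).
have Pf : P (finfun f).
  apply/andP; split; first by apply/injectiveP=> u w; rewrite !ffunE => /inj_f.
  by apply/eqP; apply: eq_imset => b; apply: eq_imset => u; rewrite ffunE.
case: (arg_minnP (fun g => emb_code gens steps g id) Pf) => g.
case/andP=> /injectiveP inj_g /eqP im_g min_g; exists g => //.
apply/andP; split; first by apply/is_embeddingP; rewrite im_g.
apply/allP=> h; rewrite mem_filter => /andP[/andP[/injectiveP inj_h /eqP im_h] _].
rewrite (emb_code_comp g h); apply: min_g; apply/andP; split.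
  by apply/injectiveP=> u w; rewrite !ffunE => /inj_g/inj_h.
rewrite -im_g -[in X in _ == X]im_h -embed_linesM.
by apply/eqP; apply: eq_imset => b; apply: eq_imset => u; rewrite ffunE.
Qed.

Lemma extend_gens g : {in gens, extend_by_steps steps third g =1 g}.
Proof.
move=> u gens_u; have : u \notin map fst steps.
  move: uniq_points; rewrite cat_uniq => /and3P[_ /hasPn disj _].
  by apply/negP=> /disj; rewrite gens_u.
rewrite /extend_by_steps; elim: (steps) g => [//|st sts IHsts] g /=.
rewrite inE negb_or => /andP[neq_u sts_u]; rewrite IHsts //.
by rewrite /do_step ffunE (negPf neq_u).
Qed.

(** By induction along the steps: the images of the two source points are known, and [f] sends the
    line to a block, so [third] returns the image of the new point. *)
Lemma extend_embedding f g : embed_lines L f \subset B ->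
  {in gens, g =1 f} -> extend_by_steps steps third g = f.
Proof.
move=> emb_f; suff agr (sts : seq (U * (U * U))) G g1 : wf_steps L G sts -> {in G, g1 =1 f} ->
    {in map fst sts ++ G, foldl (do_step third) g1 sts =1 f}.
  move=> eq_g; apply/ffunP=> u; apply: (agr _ gens) => //.
  by have := all_points u; rewrite !mem_cat orbC.
elim: sts G g1 => [//|[u [a b]] sts IHsts] G g1 /= /and4P[Ga Gb Lu wf1] eq_g w w_in.
apply: (IHsts (u :: G)) => //; last by move: w_in; rewrite inE !mem_cat inE orbCA orbA.
move=> x; rewrite inE ffunE /=; case: eqVneq => [-> _|_ /= Gx]; last exact: eq_g.
rewrite !eq_g //; apply: thirdP; rewrite -(imset_triple f (a, b, u)).
by apply: (subsetP emb_f); apply: imset_f.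
Qed.

Lemma blocks_of_image f :
  map (@block_of v) (image_lines ltr f)
  = [seq f @: (b : {set U}) | b <- map (@triple_set U) ltr].
Proof. by rewrite -!map_comp; apply: eq_map => l /=; rewrite imset_triple. Qed.

Lemma lines_of_image f :
  lines_of (image_lines ltr f) = embed_lines L f.
Proof.
have -> : embed_lines L f = [set D in map (fun b : {set U} => f @: b) (map (@triple_set U) ltr)].
  apply/setP=> D; rewrite inE; apply/imsetP/mapP => -[b b_in ->].
    by exists b; rewrite // ltr_mem.
  by exists b; rewrite // -ltr_mem.
by rewrite /lines_of blocks_of_image.
Qed.

(** Equal images force equal extensions, hence equal values on [gens]; elsewhere all assignments
    take the dummy value [x0]. So no copy is repeated. Conversely, the accepted embedding onto a
    copy is recovered from its values on [gens]. *)
Lemma pattern_lists (x0 : 'I_v) :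
  lists (fun D => D \subset B /\
           exists2 f : U -> 'I_v, injective f & embed_lines L f = D)
    (flatten (map (found gens steps ltr auts third)
                  (reassignments gens [ffun=> x0]))).
Proof.
set gs := reassignments _ _.
pose acc g := accepted gens steps ltr auts third (extend_by_steps steps third g).
have -> : flatten (map (found gens steps ltr auts third) gs)
    = [seq image_lines ltr (extend_by_steps steps third g) | g <- gs & acc g].
  by elim: gs => //= g gs ->; rewrite /found -/(acc g); case: (acc g).
set ss := map _ _.
have lines_ss : map (@lines_of v) ss
    = [seq embed_lines L (extend_by_steps steps third g) | g <- gs & acc g].
  by rewrite -map_comp; apply: eq_map => g /=; rewrite lines_of_image.
split.
- rewrite lines_ss map_inj_in_uniq; last first.
    move=> g g'; rewrite !mem_filter => /andP[acc_g gs_g] /andP[acc_g' gs_g'].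
    move/(accepted_inj acc_g acc_g') => eq_e; apply/ffunP=> u.
    have [gens_u|not_gens] := boolP (u \in gens).
      by rewrite -(extend_gens g) // eq_e extend_gens.
    by rewrite (reassignmentsP _ _ _ gs_g) // (reassignmentsP _ _ _ gs_g').
  apply: filter_uniq; apply: reassignments_uniq.
  by move: uniq_points; rewrite cat_uniq => /and3P[].
- move=> D; rewrite lines_ss; split=> [/mapP[g]|[sub_D [f inj_f def_D]]].
    rewrite mem_filter => /andP[/andP[/is_embeddingP[inj_e sub_e] _] _] ->.
    by split=> //; exists (extend_by_steps steps third g).
  have [|g acc_g im_g] := accepted_exists inj_f; first by rewrite def_D.
  pose g0 := [ffun u => if u \in gens then g u else x0].
  have ext_g0 : extend_by_steps steps third g0 = g.
    apply: extend_embedding; first by rewrite im_g def_D.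
    by move=> u gens_u; rewrite ffunE gens_u.
  apply/mapP; exists g0; last by rewrite ext_g0 im_g.
  rewrite mem_filter /acc ext_g0 acc_g; apply/reassignmentsP=> u /negPf not_gens.
  by rewrite !ffunE not_gens.
move=> a /mapP[g]; rewrite mem_filter => /andP[/andP[/is_embeddingP[inj_e _] _] _] ->.
by rewrite blocks_of_image (map_inj_uniq (imset_inj inj_e)).
Qed.

End PatternListing.

(** * From configurations to programs *)

Lemma triples_of_card3 (V : finType) (bs : seq {set V}) :
  (forall b, b \in bs -> #|b| = 3) -> exists ls, map (@triple_set V) ls = bs.
Proof.
elim: bs => [|b bs IHbs] card3; first by exists [::].
have [|ls <-] := IHbs; first by move=> b' b'_in; apply: card3; rewrite inE b'_in orbT.
have /eqP := card3 b (mem_head _ _).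
have [->|[x b_x]] := set_0Vmem b; first by rewrite cards0.
rewrite (cardsD1 x) b_x eqSS => /cards2P[y [z [_ def_b]]].
exists ((x, y, z) :: ls) => /=; congr (_ :: _).
by rewrite /triple_set /= -setUA -def_b setD1K.
Qed.

Lemma configuration_card3 (K : configuration) b : b \in lines K -> #|b| = 3.
Proof. by move=> /(subsetP (lines_sub K)); apply: (ambient_sts K).1. Qed.

Section PatternOf.

Variables (V : finType) (L : {set {set V}}).

(** The ambient system may have points off the configuration; on this subtype every point lies on a
    line, and the generators reach all of it. *)
Definition pattern_point : finType := {x | x \in cover L}.

Definition pattern_lines : {set {set pattern_point}} :=
  [set b : {set pattern_point} | val @: b \in L].

Lemma pattern_line_of (b : {set V}) : b \in L ->
  exists2 b' : {set pattern_point}, b' \in pattern_lines & val @: b' = b.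
Proof.
move=> Lb; pose b' := [set u : pattern_point | val u \in b].
have im_b' : val @: b' = b.
  apply/setP=> x; apply/imsetP/idP => [[u]|b_x]; first by rewrite inE => ? ->.
  have cov_x : x \in cover L by apply/bigcupP; exists b.
  by exists (eqtype.Sub x cov_x); rewrite ?inE SubK.
by exists b'; rewrite ?inE im_b'.
Qed.

Lemma pattern_covered (u : pattern_point) :
  exists2 b, b \in pattern_lines & u \in b.
Proof.
case/bigcupP: (valP u) => b /pattern_line_of[b' Lb' <-] /imsetP[w b'w eq_uw].
by exists b'; rewrite // (val_inj eq_uw).
Qed.

(** This trades bijections between two subtypes for plain injections into [V'], which is what the
    program enumerates. *)
Lemma isomorphic_embed (V' : finType) (D : {set {set V'}}) :
  isomorphic L D <->
  exists2 f : pattern_point -> V', injective f & embed_lines pattern_lines f = D.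
Proof.
split=> [[f [[g fK gK] iso_f]] | [f inj_f <-]].
  exists (val \o f); first by move=> u w /val_inj /(can_inj fK).
  apply/setP=> d; apply/imsetP/idP => [[b]|Dd].
    by rewrite inE iso_f => Db ->; rewrite imset_comp.
  pose d' := [set y : {x | x \in cover D} | val y \in d].
  have im_d' : val @: d' = d.
    apply/setP=> x; apply/imsetP/idP => [[u]|d_x]; first by rewrite inE => ? ->.
    have cov_x : x \in cover D by apply/bigcupP; exists d.
    by exists (eqtype.Sub x cov_x); rewrite ?inE SubK.
  have im_g : f @: (g @: d') = d' by rewrite -imset_comp (eq_imset _ gK) imset_id.
  exists (g @: d'); first by rewrite inE iso_f im_g im_d'.
  by rewrite imset_comp im_g im_d'.
have cov_f u : f u \in cover (embed_lines pattern_lines f).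
  have [b Lb b_u] := pattern_covered u.
  by apply/bigcupP; exists (f @: b); apply: imset_f.
pose f' u : {x | x \in cover (embed_lines pattern_lines f)} := eqtype.Sub (f u) (cov_f u).
have valf' (b : {set pattern_point}) : val @: (f' @: b) = f @: b.
  by rewrite -imset_comp; apply: eq_imset.
exists f'; split.
  (* Surjectivity by counting: every point covered by the image lines is a value of [f]. *)
  apply: inj_card_bij; first by move=> u w /(congr1 val)/inj_f.
  rewrite card_sig -(card_codom inj_f); apply/subset_leq_card/subsetP=> x.
  by case/bigcupP=> _ /imsetP[b _ ->] /imsetP[u _ ->]; apply: codom_f.
move=> b; rewrite valf'; apply/idP/imsetP => [Lb|[b' Lb' /(imset_inj inj_f) ->]].
  by exists b; rewrite ?inE.
by rewrite inE in Lb'.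
Qed.

(** This fits one round of the closure: its steps draw on points of earlier rounds only, never on
    each other. *)
Lemma wf_steps_cat (P : {set {set pattern_point}}) G sts1 sts2 :
  wf_steps P G sts1 ->
  (forall st, st \in sts2 -> [&& st.2.1 \in map fst sts1 ++ G,
     st.2.2 \in map fst sts1 ++ G & [set st.2.1; st.2.2; st.1] \in P]) ->
  wf_steps P G (sts1 ++ sts2).
Proof.
elim: sts1 G => [|st sts IHsts] G /= => [_ | /and4P[-> -> -> wf] wf2]; last first.
  apply: IHsts => // st2 /wf2; rewrite !inE !mem_cat !inE.
  by case/and3P=> H1 H2 ->; rewrite orbCA H1 orbCA H2.
elim: sts2 G => [//|st sts IHsts] G wf2 /=.
have /and3P[-> -> ->] := wf2 _ (mem_head _ _); apply: IHsts => st2 sts2.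
have /and3P[H1 H2 ->] : [&& st2.2.1 \in G, st2.2.2 \in G
    & [set st2.2.1; st2.2.2; st2.1] \in P] by apply: wf2; rewrite inE sts2 orbT.
by rewrite !inE H1 H2 !orbT.
Qed.

(** Each round of the closure adds one step per new point, with a chosen pair of sources. That all
    listed points lie in the iterate is what keeps the points of the next round distinct from
    them. *)
Lemma generation_steps (V0 : {set V}) k :
  V0 \subset cover L ->
  exists steps, let pts := points (enum [set u : pattern_point | val u \in V0]) steps in
  [/\ wf_steps pattern_lines (enum [set u : pattern_point | val u \in V0]) steps,
      uniq pts, (forall u, u \in pts -> val u \in iter k (gen_step L) V0)
    & forall u : pattern_point, val u \in iter k (gen_step L) V0 -> u \in pts].
Proof.
set gens := enum _ => sub_V0.
have subA : iter k (gen_step L) V0 \subset cover L.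
  elim: k => //= k IHk; apply/subsetP=> z; rewrite inE => /orP[/(subsetP IHk)//|].
  rewrite inE => /existsP[x /andP[_ /existsP[y /andP[_ Lz]]]].
  by apply/bigcupP; exists [set x; y; z]; rewrite // !inE eqxx orbT.
elim: k subA => [|k IHk] /= subA.
  exists [::]; rewrite /points cats0; split=> //; rewrite ?enum_uniq //.
    by move=> u; rewrite mem_enum inE.
  by move=> u; rewrite mem_enum inE.
have [|steps [wf uniq_pts sub_pts pts_sub]] := IHk.
  exact: subset_trans (gen_step_sub L _) subA.
set A := iter k (gen_step L) V0 in sub_pts pts_sub subA *; set pts := points _ _ in uniq_pts sub_pts pts_sub.
pose good (u : pattern_point) (p : pattern_point * pattern_point) :=
  [&& p.1 \in pts, p.2 \in pts & [set p.1; p.2; u] \in pattern_lines].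
(* The default [(u, u)] never occurs for a point of [new]. *)
pose src u := odflt (u, u) [pick p | good u p].
pose new := enum [set u : pattern_point | (val u \in gen_step L A) && (val u \notin A)].
have new_good u : u \in new -> good u (src u).
  rewrite mem_enum inE => /andP[]; rewrite inE => /orP[->//|].
  rewrite inE => /existsP[x /andP[Ax /existsP[y /andP[Ay Lu]]]] _.
  rewrite /src; case: pickP => [p //|/=].
  have cov z : z \in A -> z \in cover L.
    by move=> Az; apply: (subsetP subA); rewrite inE Az.
  move/(_ (eqtype.Sub x (cov x Ax), eqtype.Sub y (cov y Ay)))/negbT; case/negP; apply/and3P; split.
  - by apply: pts_sub; rewrite SubK.
  - by apply: pts_sub; rewrite SubK.
  by rewrite inE !imsetU !imset_set1 !SubK.
exists (steps ++ [seq (u, src u) | u <- new]).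
have -> : points gens (steps ++ [seq (u, src u) | u <- new]) = pts ++ new.
  by rewrite /points map_cat -map_comp map_id catA.
split.
- apply: wf_steps_cat => // _ /mapP[u new_u ->] /=.
  have /and3P[in1 in2 ->] := new_good u new_u.
  by move: in1 in2; rewrite !mem_cat andbT orbC => -> ; rewrite orbC => ->.
- rewrite cat_uniq uniq_pts enum_uniq andbT; apply/hasPn=> u.
  by rewrite mem_enum inE => /andP[_]; apply: contra => /sub_pts.
- move=> u; rewrite mem_cat mem_enum inE => /orP[/sub_pts Au|/andP[//]].
  by rewrite inE Au.
move=> u A'u; rewrite mem_cat mem_enum inE A'u /=.
by have [Au|_] := boolP (val u \in A); rewrite ?orbT // pts_sub.
Qed.

End PatternOf.

Lemma generated_by_card_gt1 m (K : configuration) :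
  0 < m -> generated_by_card m K -> 1 < m.
Proof.
case: m => [|[|m]] // _ [V0 [sub_V0 /eqP/cards1P[x def_V0]]]; rewrite /generated_by.
rewrite {}def_V0 in sub_V0 *; rewrite sub1set in sub_V0.
(* [gen_step] admits equal sources, but a set [[set x; x; z]] has at most two points and is no
   line. *)
have step_x : gen_step (lines K) [set x] = [set x].
  apply/setP=> z; rewrite !inE; case: eqP => // neq_zx; apply/existsP=> -[x1].
  case/andP=> /set1P-> /existsP[y1 /andP[/set1P->]] /configuration_card3.
  by rewrite setUid cards2; case: (_ == _).
rewrite /gen_closure iter_fix // => cov_x.
case/bigcupP: sub_V0 => b Lb b_x; have := configuration_card3 Lb.
have : #|b| <= #|[set x]| by rewrite cov_x; apply/subset_leq_card/bigcup_sup.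
by rewrite cards1 => le1 card3; rewrite card3 in le1.
Qed.

Lemma configuration_program m (K : configuration) : generated_by_card m K ->
  exists (p : prog) (c k : nat),
  forall (v : nat) (B : {set {set 'I_v}}) (third : 'I_v -> 'I_v -> 'I_v)
    (base : nat) (M : nat -> nat),
    0 < v -> is_sts B -> (forall x y z, [set x; y; z] \in B -> third x y = z) ->
    (forall x y : 'I_v, M (cell v base x y) = third x y) ->
    base <= 3 * (v * v) + 2 ->
    exists2 ss, lists (fun D => D \subset B /\ isomorphic (lines K) D) ss &
      forall W s, (v + 2) ^ k <= W -> ready v base M s ->
        runs_in W p s (c * v.+1 ^ m) (fun s' =>
          ready v base M s' /\ outp s' = outp s ++ output_of ss).
Proof.
move=> [V0 [sub_V0 card_V0 gen_V0]].
have [steps [wf uniq_pts _ pts_all]] :=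
  generation_steps #|ambient_points K| sub_V0.
set L := pattern_lines _ in wf; set gens := enum _ in wf uniq_pts pts_all.
have all_pts u : u \in points gens steps.
  by apply: pts_all; move: gen_V0; rewrite /generated_by /gen_closure => ->; apply: valP.
have card3 b : b \in L -> #|b| = 3.
  by rewrite inE => /configuration_card3; rewrite card_imset //; apply: val_inj.
have [ltr def_ltr] : exists ltr, map (@triple_set _) ltr = enum L.
  by apply: triples_of_card3 => b; rewrite mem_enum; apply: card3.
have uniq_ltr : uniq (map (@triple_set _) ltr) by rewrite def_ltr enum_uniq.
have mem_ltr : map (@triple_set _) ltr =i L by move=> b; rewrite def_ltr mem_enum.
have size_gens : size gens = m.
  rewrite -card_V0 -cardE -(card_imset _ val_inj); apply: eq_card => x.
  apply/imsetP/idP => [[u]|V0x]; first by rewrite inE => ? ->.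
  by exists (eqtype.Sub x (subsetP sub_V0 x V0x)); rewrite ?inE SubK.
pose auts := automorphisms L.
pose c := cost (body_prog gens steps ltr auts).
(* The summands of the exponent make room in a word for the codes of embeddings, for the constant
   [size ltr], and for the table addresses, which are below [4 * (v * v) + 2]. *)
exists (nest gens steps ltr auts gens), (c + 2 * m), (size (points gens steps) + size ltr + 4).
move=> v B third base M v_gt0 stsB thirdP M_third le_base; pose x0 := Ordinal v_gt0.
exists (flatten (map (found gens steps ltr auts third)
                  (reassignments gens [ffun=> x0]))).
  have [H1 H2 H3] := pattern_lists all_pts uniq_pts wf uniq_ltr mem_ltr card3
    (@pattern_covered _ _) stsB thirdP x0.
  by split=> // D; rewrite H2 isomorphic_embed.
move=> W s leW rs.
set n := size (points gens steps) in leW; set q := size ltr in leW.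
have pos j : 0 < (v + 2) ^ j by rewrite expn_gt0 addn2.
have W1 : (v + 2) ^ n <= W.
  by apply: leq_trans leW; rewrite leq_pexp2l ?addn2 // -addnA leq_addr.
have W2 : q < W.
  apply: leq_trans (leq_trans _ leW); first exact: (ltn_expl q (isT : 1 < 2)).
  apply: (@leq_trans ((v + 2) ^ q)); first by case: (q) => // q'; rewrite leq_exp2r // leq_addl.
  by rewrite leq_pexp2l ?addn2 // addnAC leq_addl.
have W3 : (v + 2) ^ 4 <= W.
  by apply: leq_trans leW; rewrite leq_pexp2l ?addn2 // leq_addl.
have W4 : (v + 2) ^ 4 >= 4 * (v * v) + v + 4.
  by rewrite !expnS expn0 muln1; nia.
have leW_cell : v * v + base <= W by lia.
have leW_code : v ^ n <= W.
  by apply: leq_trans W1; case: (n) => // n'; rewrite leq_exp2r // leq_addr.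
have ltW_1 : 1 < W by lia.
have ltW : v < W by lia.
have body g1 s1 (rs1 : ready v base M s1) (ag1 : agree gens steps gens g1 s1) :=
  ok_body auts all_pts M_third leW_cell leW_code W2 ltW_1 wf
    (extend_gens uniq_pts third g1) rs1 ag1.
have gens_nil : gens ++ [::] =i gens by rewrite cats0.
have uniq_gens : uniq (gens ++ [::]) by rewrite cats0 enum_uniq.
have agree_nil : agree gens steps [::] [ffun=> x0] s by [].
have := runs_in_nest all_pts ltW_1 ltW body gens_nil uniq_gens rs agree_nil.
by rewrite size_gens => run; apply: runs_in_weaken run _ _ => // s' [].
Qed.

(** * Isomorphism classes and unions of listings *)

Lemma isomorphic_sym (V1 V2 : finType) (L1 : {set {set V1}}) (L2 : {set {set V2}}) :
  isomorphic L1 L2 -> isomorphic L2 L1.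
Proof.
case=> f [[g fK gK] iso_f]; exists g; split; first by exists f.
move=> b; have im_g : f @: (g @: b) = b by rewrite -imset_comp (eq_imset _ gK) imset_id.
by rewrite iso_f im_g.
Qed.

Lemma isomorphic_trans (V1 V2 V3 : finType) (L1 : {set {set V1}})
    (L2 : {set {set V2}}) (L3 : {set {set V3}}) :
  isomorphic L1 L2 -> isomorphic L2 L3 -> isomorphic L1 L3.
Proof.
case=> f [bij_f iso_f] [g [bij_g iso_g]]; exists (g \o f); split.
  exact: bij_comp.
by move=> b; rewrite iso_f iso_g (imset_comp g f).
Qed.

(** Injections between finite sets can be searched, so the program can be chosen by this case split
    without excluded middle. *)
Lemma isomorphic_dec (V1 V2 : finType) (L1 : {set {set V1}}) (L2 : {set {set V2}}) :
  isomorphic L1 L2 \/ ~ isomorphic L1 L2.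
Proof.
have [/existsP[f /andP[/injectiveP inj_f /eqP im_f]]|no_f] := boolP
  [exists f : {ffun pattern_point L1 -> V2},
     injectiveb f && (embed_lines (pattern_lines L1) f == L2)].
  by left; apply/isomorphic_embed; exists f.
right=> /isomorphic_embed[f inj_f im_f]; case/existsP: no_f; exists (finfun f).
apply/andP; split; first by apply/injectiveP=> u w; rewrite !ffunE => /inj_f.
rewrite -im_f; apply/eqP; apply: eq_imset => b.
by apply: eq_imset => u; rewrite ffunE.
Qed.

Lemma lists_cat v (P1 P2 : {set {set 'I_v}} -> Prop) ss1 ss2 :
  (forall D, P1 D -> P2 D -> False) -> lists P1 ss1 -> lists P2 ss2 ->
  lists (fun D => P1 D \/ P2 D) (ss1 ++ ss2).
Proof.
move=> disj [uniq1 mem1 blk1] [uniq2 mem2 blk2]; split.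
- rewrite map_cat cat_uniq uniq1 uniq2 andbT; apply/hasPn=> D /mem2 P2D.
  by apply/negP=> /mem1 /disj; apply.
- move=> D; rewrite map_cat mem_cat; split=> [/orP[/mem1|/mem2]|[/mem1 ->|/mem2 ->]];
    by [left | right | rewrite ?orbT].
by move=> a; rewrite mem_cat => /orP[/blk1|/blk2].
Qed.

Lemma eq_lists v (P1 P2 : {set {set 'I_v}} -> Prop) ss :
  (forall D, P1 D <-> P2 D) -> lists P1 ss -> lists P2 ss.
Proof. by move=> eqP12 [uniq_ss mem_ss blk_ss]; split=> // D; rewrite mem_ss. Qed.

Lemma lists_exactly_once_of v (P : {set {set 'I_v}} -> Prop) ss :
  lists P ss -> lists_exactly_once P (output_of ss).
Proof.
case=> uniq_ss mem_ss blk_ss; exists (map (@lines_of v) ss), ss.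
split=> //; rewrite ?size_map // => i lt_i; rewrite (nth_map [::]) //; split.
  by apply: blk_ss; apply: mem_nth.
by move=> b; rewrite inE.
Qed.

(** Induction on the list [js]. Each program restores [ready], so they can be run one after the
    other on the same table, and their times add up. *)
Lemma configurations_program m (I : eqType) (C : I -> configuration) (js : seq I) :
  (forall i, generated_by_card m (C i)) ->
  exists (p : prog) (c k : nat),
  forall (v : nat) (B : {set {set 'I_v}}) (third : 'I_v -> 'I_v -> 'I_v)
    (base : nat) (M : nat -> nat),
    0 < v -> is_sts B -> (forall x y z, [set x; y; z] \in B -> third x y = z) ->
    (forall x y : 'I_v, M (cell v base x y) = third x y) ->
    base <= 3 * (v * v) + 2 ->
    exists2 ss, lists (fun D => D \subset B /\
        exists2 i, i \in js & isomorphic (lines (C i)) D) ss &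
      forall W s, (v + 2) ^ k <= W -> ready v base M s ->
        runs_in W p s (c * v.+1 ^ m) (fun s' =>
          ready v base M s' /\ outp s' = outp s ++ output_of ss).
Proof.
move=> genC; elim: js => [|i js [p2 [c2 [k2 spec2]]]].
  exists Skip, 1, 0 => v B third base M v_gt0 _ _ _ _; exists [::].
    by split=> // D; split=> // -[_ [j]].
  move=> W s _ rs; apply: (runs_in_weaken (T := 1)).
  - exact: (@ok_skip W s (eq s)).
  - by rewrite mul1n expn_gt0.
  by move=> _ <-; rewrite cats0.
have [[j js_j iso_ij]|noniso] : (exists2 j, j \in js & isomorphic (lines (C i)) (lines (C j)))
    \/ forall j, j \in js -> ~ isomorphic (lines (C i)) (lines (C j)).
  elim: js {spec2} => [|j js IHjs]; first by right.
  have [iso|niso] := isomorphic_dec (lines (C i)) (lines (C j)).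
    by left; exists j; rewrite ?mem_head.
  case: IHjs => [[j' js_j' iso]|no]; first by left; exists j'; rewrite // inE js_j' orbT.
  by right=> j'; rewrite inE => /orP[/eqP->|/no].
- exists p2, c2, k2 => v B third base M v_gt0 stsB thirdP M_third le_base.
  have [ss lists_ss run_ss] := spec2 v B third base M v_gt0 stsB thirdP M_third le_base.
  exists ss => //; apply: eq_lists lists_ss => D; split=> -[sub_D [j' js_j' iso]];
    split=> //.
    by exists j'; rewrite // inE js_j' orbT.
  move: js_j' iso; rewrite inE => /orP[/eqP->|js_j' iso]; last by exists j'.
  by move/(isomorphic_trans (isomorphic_sym iso_ij)); exists j.
have [p1 [c1 [k1 spec1]]] := configuration_program (genC i).
exists (Seq p1 p2), (c1 + c2), (k1 + k2) => v B third base M v_gt0 stsB thirdP M_third le_base.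
have [ss1 lists1 run1] := spec1 v B third base M v_gt0 stsB thirdP M_third le_base.
have [ss2 lists2 run2] := spec2 v B third base M v_gt0 stsB thirdP M_third le_base.
exists (ss1 ++ ss2).
  apply: eq_lists (lists_cat _ lists1 lists2) => D.
    split=> [[[sub_D iso]|[sub_D [j js_j iso]]]|[sub_D [j]]].
    - by split=> //; exists i; rewrite ?mem_head.
    - by split=> //; exists j; rewrite // inE js_j orbT.
    by rewrite inE => /orP[/eqP-> iso|js_j iso]; [left | right; split=> //; exists j].
  (* A copy found by both programs would make [C i] isomorphic to some [C j] with [j] in [js]. *)
  move=> [_ iso_i] [_ [j js_j iso_j]]; case: (noniso j js_j).
  exact: isomorphic_trans iso_i (isomorphic_sym iso_j).
move=> W s leW rs; rewrite mulnDl.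
have [leW1 leW2] : (v + 2) ^ k1 <= W /\ (v + 2) ^ k2 <= W.
  by split; apply: leq_trans leW; rewrite leq_pexp2l ?addn2 // ?leq_addr ?leq_addl.
apply: runs_in_seq; apply: runs_in_weaken (run1 W s leW1 rs) _ _ => // s1 [rs1 out1].
apply: runs_in_weaken (run2 W s1 leW2 rs1) _ _ => // s2 [rs2 out2].
by split; rewrite // out2 out1 /output_of map_cat flatten_cat catA.
Qed.

(** * The program for the whole collection *)

Lemma sts_input_small v (s : seq (triple v)) W :
  v < W -> size s < W -> all (fun x => x < W) (sts_input s).
Proof.
move=> ltv lts; rewrite /= ltv lts /=; apply/allP=> x /flatten_mapP[[[a b] c] _].
by rewrite !inE => /or3P[] /eqP->; apply: ltn_trans ltv; apply: ltn_ord.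
Qed.

Theorem theorem1 (m : nat) (I : finType) (C : I -> configuration) :
  0 < m ->
  (forall i, generated_by_card m (C i)) ->
  exists (p : prog) (c k : nat),
  forall (v : nat) (B : {set {set 'I_v}}) (s : seq (triple v)),
    is_sts B -> block_list s B ->
    exists (t : nat) (output : seq nat),
      [/\ runs p ((v + 2) ^ k) (sts_input s) t output,
          0 < v -> t <= c * v ^ m
        & lists_exactly_once
            (fun D => D \subset B /\ exists i, isomorphic (lines (C i)) D)
            output].
Proof.
move=> m_gt0 genC.
have lists_nil v (P : {set {set 'I_v}} -> Prop) : (forall D, ~ P D) -> lists P [::].
  by move=> noP; split=> // D; split=> // /noP.
have W4 v : 4 * (v * v) + v + 4 <= (v + 2) ^ 4 by rewrite !expnS expn0 muln1; nia.
have input_ok v (B : {set {set 'I_v}}) (s : seq (triple v)) k : is_sts B ->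
    block_list s B -> all (fun x => x < (v + 2) ^ (k + 4)) (sts_input s).
  move=> stsB listB; have le_s := size_block_list stsB listB; have leW := W4 v.
  have leWk : (v + 2) ^ 4 <= (v + 2) ^ (k + 4).
    by rewrite leq_pexp2l ?addn2 // leq_addl.
  by apply: sts_input_small; lia.
(* For [m = 1] the collection is empty, and so is the output; a table of quadratic size would not be
   affordable there. *)
have [m_gt1|m_le1] := ltnP 1 m; last first.
  have no_i (i : I) : False.
    by have := generated_by_card_gt1 m_gt0 (genC i); rewrite ltnNge m_le1.
  exists Skip, 1, 4 => v B s stsB listB; exists 1, [::]; split.
  - split; first exact: (input_ok v B s 0).
    by exists (init_state (sts_input s)) => //; constructor.
  - by move=> v_gt0; rewrite mul1n expn_gt0 v_gt0.
  by apply: lists_exactly_once_of (lists_nil _ _ _) => D [_ [i]].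
have [p [c [k spec]]] := configurations_program (enum I) genC.
exists (Seq (Fetch r_v r_zero) (If CmpEq r_v r_zero Skip (Seq table_prog p))).
(* The 10 consists of the 8 units around the table loop, the fetch of [v] and the test for [v = 0].
   The additional exponent 4 gives room for the input and the table. *)
exists ((cost table_body).+1 + 10 + c * 2 ^ m), (k + 4) => v B s stsB listB.
have ok_in := input_ok v B s k stsB listB.
set W := (v + 2) ^ (k + 4) in ok_in *.
have leW4 : (v + 2) ^ 4 <= W by rewrite leq_pexp2l ?addn2 // leq_addl.
have leWk : (v + 2) ^ k <= W by rewrite leq_pexp2l ?addn2 // leq_addr.
(* For [v = 0] there is nothing to list: since [0 < m], a configuration has a generator, and it
   would need an image. *)
have [v0|v_gt0] := posnP v.
  exists (1 + 2), [::]; split; [split=> // | by [] | ].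
    exists (set_reg (init_state (sts_input s)) r_v v) => //.
    apply: ExecSeq (ExecFetch _ _ _ _) _.
    by apply: ExecIfTrue (ExecSkip _ _); rewrite /= /upd /= v0.
  apply: lists_exactly_once_of (lists_nil _ _ _) => D [_ [i /isomorphic_embed[f _ _]]].
  have [V0 [sub_V0 card_V0 _]] := genC i.
  have [V00|[x V0x]] := set_0Vmem V0; first by rewrite -card_V0 V00 cards0 in m_gt0.
  by have := ltn_ord (f (eqtype.Sub x (subsetP sub_V0 x V0x))); rewrite [in X in _ < X]v0.
have le_s := size_block_list stsB listB; have leW := W4 v.
have run : runs_in W (Seq (Fetch r_v r_zero) (If CmpEq r_v r_zero Skip (Seq table_prog p)))
    (init_state (sts_input s))
    (1 + (size s * (cost table_body).+1 + 8 + c * v.+1 ^ m).+1)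
    (fun s' => lists_exactly_once
      (fun D => D \subset B /\ exists i, isomorphic (lines (C i)) D) (outp s')).
  apply: runs_in_seq; apply: ok_fetch => /=; apply: runs_in_if => /=.
    by rewrite /upd /= => /eqP v0; rewrite v0 in v_gt0.
  move=> _; apply: runs_in_seq.
  apply: runs_in_weaken (runs_in_table_prog stsB listB _ _ _ _ _) _ _ => //.
    by rewrite /table_base; lia.
  move=> s1 [out1 [third [M [thirdP M_third rs1]]]].
  have [|ss lists_ss run_ss] := spec v B third (table_base s) M v_gt0 stsB thirdP M_third.
    by rewrite /table_base; lia.
  apply: runs_in_weaken (run_ss W s1 leWk rs1) _ _ => // s2 [_ ->].
  rewrite out1 /=; apply: lists_exactly_once_of; apply: eq_lists lists_ss => D.
  by split=> -[sub_D [i]]; [move=> _ | ] => iso; split=> //; exists i; rewrite ?mem_enum.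
have [t [s' [ex le_t out']]] := run; exists t, (outp s'); split=> //.
  by split=> //; exists s'.
move=> _; apply: leq_trans le_t _.
have v2 : v * v <= v ^ m by rewrite mulnn leq_pexp2l.
(* This uses [v.+1 <= 2 * v], which holds since [v] is positive. *)
have vm : v.+1 ^ m <= 2 ^ m * v ^ m by rewrite -expnMn leq_exp2r //; lia.
have vm_gt0 : 0 < v ^ m by rewrite expn_gt0 v_gt0.
have h1 : size s * (cost table_body).+1 <= (cost table_body).+1 * v ^ m.
  by rewrite mulnC leq_mul2l (leq_trans le_s v2) orbT.
have h2 : c * v.+1 ^ m <= c * 2 ^ m * v ^ m by rewrite -mulnA leq_mul2l vm orbT.
by rewrite !mulnDl; lia.
Qed.
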